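(* A natural number $p>1$ is prime if and only if $\binom{q}{p}-\left\lfloor \frac{q}{p}\right\rfloor$ is divisible by $p$ for every prime number $q$.
   Context: $\binom{q}{p}$ is the number of ways to choose $p$ elements out of $q$ elements (so it is $0$ when $q<p$), and $\lfloor x\rfloor$ is the greatest integer not exceeding the real number $x$. *)

(* Defs.v *)
From mathcomp Require Import all_boot all_order all_algebra.

(* Main.v *)
(** For prime [p], Vandermonde's identity gives [C(q + p, p) = C(q, p) + 1] mod [p], so both sides
    of the congruence grow by one when [q] grows by [p].

    For composite [n], [C(q, n)] and [q / n] modulo [n] depend only on [q] modulo [N = n^(n+1)], so
    by Dirichlet's theorem it is enough to exhibit a residue [b], prime to [n], where the congruence
    fails: [b = -1] if [n] is even, and [b = n + s + 1] with [s] the least prime factor of [n] if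
    [n] is odd.

    Dirichlet's theorem is proved by Shapiro's method, but in the real group algebra of
    [G = (Z/N)^*] instead of with complex characters.  Let [lam_x] be the sum of [Lambda(d)/d . d]
    over [d <= x] prime to [N], and let [c] be the element of the algebra that records the values
    at 1 of the L-functions.  Then [lam_x * c = O(1)] up to a multiple of the trivial idempotent,
    while [lam_x] acts as [- ln x] on the annihilator of [c].  Hence [lam_x = ln x (1/|G| - e) + O(1)], where
    [e] is the symmetric idempotent generating that annihilator.  Positivity of [lam_x] gives
    [e <= 1/|G|] pointwise, which forces [e = 0] or [e = chi/|G|] for a real character [chi] with
    [L(1, chi) = 0].  Monsky's argument excludes the second case: the Lambert series
    [sum chi(n) t^n / (1 - t^n)] would stay bounded as [t] tends to 1, although its power
    series coefficients are nonnegative and at least 1 at the squares. *)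
Require Import Defs.
From mathcomp Require Import all_boot all_order all_algebra.
From mathcomp Require Import fingroup boolp classical_sets zify ring lra reals sequences exp
  Rstruct.

Set Implicit Arguments.
Unset Strict Implicit.
Unset Printing Implicit Defensive.

(** * Binomial coefficients modulo n *)

(** Put [M = k n^(n+1)]. From [i C(M, i) = M C(M - 1, i - 1)], the valuation of [C(M, i)] at a prime
    factor of [n] is at least [(n+1) v(n) - v(i)], and [v(i) < i <= n] makes this at least
    [v(n)]. *)
Lemma dvdn_bin_pow n k i : (0 < n)%N -> (0 < i <= n)%N -> (n %| 'C(k * n ^ n.+1, i))%N.
Proof.
move=> n_gt0 /andP[i_gt0 le_in].
have [/eqP->|C_gt0] := boolP ('C(k * n ^ n.+1, i) == 0)%N; first exact: dvdn0.
rewrite -lt0n in C_gt0.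
apply/(dvdn_partP _ n_gt0) => s; rewrite mem_primes => /and3P[s_pr _ s_n].
rewrite p_part pfactor_dvdn //.
have sn_gt0 : (0 < logn s n)%N by rewrite logn_gt0 mem_primes s_pr n_gt0.
have N_gt0 : (0 < k * n ^ n.+1)%N by move: C_gt0; rewrite bin_gt0; lia.
have: (s ^ (n.+1 * logn s n) %| i * 'C(k * n ^ n.+1, i))%N.
  rewrite -[i](prednK i_gt0) -[(k * _)%N](prednK N_gt0) -mul_bin_diag prednK //.
  rewrite dvdn_mulr // dvdn_mull // mulnC expnM.
  by apply: dvdn_exp2r; rewrite pfactor_dvdn.
rewrite pfactor_dvdn ?muln_gt0 ?i_gt0 // lognM //.
have: (logn s i < i)%N by rewrite ltn_logl.
nia.
Qed.

(** In Vandermonde's identity, only the term choosing nothing from the block of size [k n^(n+1)]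
    survives modulo [n]. *)
Lemma bin_modD_pow n k b : (0 < n)%N ->
  'C(b + k * n ^ n.+1, n) = 'C(b, n) %[mod n].
Proof.
move=> n_gt0; rewrite addnC -binomial.Vandermonde big_ord_recl bin0 mul1n subn0.
rewrite -modnDmr (_ : (\sum_(i < n) _) %% n = 0)%N ?addn0 //.
apply/eqP/dvdn_sum => i _; apply: dvdn_mulr; apply: dvdn_bin_pow => //.
exact: (ltn_ord i).
Qed.

Lemma prime_bin_mod p q : prime p -> 'C(q, p) = q %/ p %[mod p].
Proof.
move=> p_pr; have p_gt0 := prime_gt0 p_pr.
have [m] := ubnP q; elim: m q => // m IH q lt_qm.
have [lt_qp|le_pq] := ltnP q p; first by rewrite bin_small // divn_small.
rewrite -[q in LHS](subnKC le_pq) -binomial.Vandermonde -[q in RHS](subnKC le_pq).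
rewrite divnDl // divnn p_gt0.
case: p p_pr p_gt0 le_pq IH => // p p_pr _ le_pq IH.
rewrite big_ord_recl big_ord_recr /= bin0 subn0 mul1n binn /bump add1n subnn bin0.
rewrite muln1 -[in RHS]addn1 -[RHS]modnDml -IH ?modnDml; last lia.
rewrite addnCA -modnDml (_ : ((\sum_(i < p) _) %% _ = 0)%N) //.
apply/eqP/dvdn_sum => i _; apply: dvdn_mulr; rewrite prime_dvd_bin //.
by rewrite /bump /= add1n ltnS ltn_ord.
Qed.

Lemma dvdz_subn n a b : (Posz n %| (Posz a - Posz b)%R)%Z <-> a = b %[mod n].
Proof.
rewrite -eqz_mod_dvd !modz_nat. split=> [/eqP[]|->] //.
Qed.

(** Neighbouring entries of this row add up to some [C(n^(n+1), j+1)], which is 0 modulo [n]; so the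
    row alternates between 1 and -1. *)
Lemma bin_pred_pow_mod n i : (0 < n)%N -> (i <= n)%N -> ~~ odd i ->
  'C((n ^ n.+1).-1, i) = 1 %[mod n].
Proof.
move=> n_gt0 + +; have N_gt0 : (0 < n ^ n.+1)%N by rewrite expn_gt0 n_gt0.
have step j : (j < n)%N -> 'C((n ^ n.+1).-1, j) + 'C((n ^ n.+1).-1, j.+1) = 0 %[mod n].
  move=> lt_jn; rewrite addnC -binS prednK // mod0n; apply/eqP.
  by rewrite -[(n ^ _)%N]mul1n; apply: dvdn_bin_pow.
have [m] := ubnP i; elim: m i => // m IH [|[|i]] //; first by rewrite bin0.
rewrite /= negbK => lt_im lt_in ev_i.
rewrite -(IH i) //; [|lia|lia].
have /eqP := step i.+1 lt_in; have /eqP := step i (ltnW lt_in).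
rewrite !mod0n -!/(dvdn _ _) => d1 d2; apply/eqP.
have := dvdn_sub d2 d1; have := dvdn_sub d1 d2.
set x := 'C(_, i); set y := 'C(_, i.+1); set z := 'C(_, i.+2) => d3 d4.
have [le|le] := leqP x z; first by rewrite eqn_mod_dvd //; congr (_ %| _): d4; lia.
by rewrite eq_sym eqn_mod_dvd 1?ltnW //; congr (_ %| _): d3; lia.
Qed.

Lemma prime_ndvd_fact s k : prime s -> (k < s)%N -> ~~ (s %| k`!).
Proof.
move=> s_pr; elim: k => [|k IH] lt_ks; first by rewrite Euclid_dvd1.
by rewrite factS Euclid_dvdM // negb_or IH ?gtnNdvd // ltnW.
Qed.

(* If [n = s m], then [u C(n + s + 1, n) = (m + 1) u] mod [n] for
   [u = (s-1)! (s+1)], which is prime to [s]. *)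
Lemma bin_addn_prime_divisor n s : prime s -> (s %| n) -> (0 < n)%N ->
  'C(n + s.+1, n) <> 1 %[mod n].
Proof.
move=> s_pr s_n n_gt0 C1; have s_gt1 := prime_gt1 s_pr.
set u := ((s.-1)`! * s.+1)%N.
have su : ~~ (s %| u).
  rewrite Euclid_dvdM // negb_or prime_ndvd_fact //; last lia.
  by rewrite -addn1 dvdn_addr // Euclid_dvd1.
have ff k : ((n + k) ^_ k = k`! %[mod n]).
  rewrite ffact_prod fact_prod big_add1 big_mkord /=.
  rewrite (reindex_inj rev_ord_inj) /=.
  elim/big_rec2: _ => // i x y _ IH; rewrite -modnMm IH modnMm -modnMml.
  by rewrite (_ : (n + k - (k - i.+1) = i.+1 + n)%N) ?modnDr ?modnMml //; have := ltn_ord i; lia.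
have key : (u * 'C(n + s.+1, n) = (n %/ s).+1 * u %[mod n])%N.
  (* Since [s u = (s+1)!], multiplying by [s] turns the left side into a falling factorial, whose
     factor [n + s = s (n/s + 1)] gives the [s] back. *)
  have e : (u * 'C(n + s.+1, n) = (n %/ s).+1 * ((n + s.+1) * (n + s.-1) ^_ s.-1))%N.
    apply/eqP; rewrite -(eqn_pmul2l (prime_gt0 s_pr)); apply/eqP.
    transitivity (s.+1`! * 'C(n + s.+1, n))%N.
      by rewrite mulnA /u mulnA [(s * _)%N in LHS]mulnC factS -[in s`!](prednK
        (prime_gt0 s_pr)) factS prednK ?prime_gt0 //; lia.
    have ns : (n + s = s * (n %/ s).+1)%N by rewrite mulnS mulnC divnK // addnC.
    rewrite -bin_sub ?leq_addr // addKn mulnC bin_ffact addnS ffactSS ns.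
    rewrite -[X in _ * (_ ^_ X)](prednK (prime_gt0 s_pr)) ffactnS -ns.
    by rewrite -subn1 -addnBA ?prime_gt0 // subn1 ns; lia.
  have e2 : ((n + s.+1) * (n + s.-1) ^_ s.-1 = s.+1 * (s.-1)`! %[mod n])%N.
    by rewrite -modnMm ff modnDl modnMm.
  by rewrite e -modnMmr e2 modnMmr /u [((s.-1)`! * _)%N]mulnC.
(* If the binomial were 1, [n] would divide [(n/s) u], that is, [s] would divide [u]. *)
move: key; rewrite -modnMmr C1 modnMmr muln1 mulSn => /eqP.
rewrite -[X in X == _ %[mod _]]addn0 eqn_modDl mod0n eq_sym => d.
case/negP: su; have m_gt0 : (0 < n %/ s)%N by rewrite divn_gt0 ?prime_gt0 // dvdn_leq.
by rewrite -(dvdn_pmul2l m_gt0) divnK.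
Qed.

Lemma composite_residue n : (1 < n)%N -> ~~ prime n ->
  exists b, [/\ (b < n ^ n.+1)%N, coprime b n & 'C(b, n) <> b %/ n %[mod n]].
Proof.
move=> n_gt1 n_npr; have n_gt0 := ltnW n_gt1.
have powS : (n ^ n.+1 = n ^ n * n)%N by rewrite expnSr.
have npow_gt0 : (0 < n ^ n)%N by rewrite expn_gt0 n_gt0.
have [n_odd|n_even] := boolP (odd n); last first.
  have n_gt2 : (2 < n)%N by rewrite ltn_neqAle n_gt1 andbT; apply: contraNneq n_npr => <-.
  exists (n ^ n.+1).-1; split; first by rewrite prednK // powS muln_gt0 npow_gt0.
    by rewrite (@coprime_dvdr _ (n ^ n.+1)) ?powS ?dvdn_mull // coprimePn // muln_gt0 npow_gt0.
  (* The binomial is 1 while [b / n = n^n - 1] is -1 modulo [n]; these differ because [n > 2]. *)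
  rewrite bin_pred_pow_mod // powS.
  rewrite (_ : (n ^ n * n).-1 = ((n ^ n).-1 * n + n.-1)%N); last first.
    by rewrite -[in LHS](prednK npow_gt0) mulSn; lia.
  rewrite divnMDl // divn_small ?addn0 ?prednK // => e.
  have : (1 + 1 = (n ^ n).-1 + 1 %[mod n])%N by rewrite -modnDml e modnDml.
  rewrite [X in _ = X %[mod _]]addn1 prednK // modn_small // => /esym/eqP.
  by rewrite (_ : n ^ n %% n = 0)%N //; apply/eqP; apply: dvdn_exp.
set s := pdiv n; have s_pr : prime s by apply: pdiv_prime.
have s_n : s %| n by apply: pdiv_dvd.
have s_odd : odd s by apply: dvdn_odd s_n n_odd.
have s2 : (2 < s)%N by have := prime_gt1 s_pr; move: s_odd; case: (s) => [|[|[|]]].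
have ss : (s ^ 2 <= n)%N by rewrite leqNgt; apply: contra n_npr => h; rewrite ltn_pdiv2_prime.
have lt_sn : (s.+1 < n)%N by nia.
exists (n + s.+1)%N; split.
- have : (n ^ 1 <= n ^ n)%N by rewrite leq_pexp2l.
  by rewrite powS expn1; nia.
- rewrite coprime_sym /coprime gcdnDl; apply/negPn/negP => g1.
  have g_gt1 : (1 < gcdn n s.+1)%N by rewrite ltn_neqAle eq_sym g1 gcdn_gt0 n_gt0.
  (* A common prime factor [r] of [n] and [s + 1] is [s] or [s + 1]; but [s] does not divide
     [s + 1], and [s + 1] is even while [n] is odd. *)
  set r := pdiv (gcdn n s.+1); have r_pr : prime r by apply: pdiv_prime.
  have r_g : r %| gcdn n s.+1 by apply: pdiv_dvd.
  have r_n : r %| n by apply: dvdn_trans r_g (dvdn_gcdl _ _).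
  have r_s : r %| s.+1 by apply: dvdn_trans r_g (dvdn_gcdr _ _).
  have le_sr : (s <= r)%N by apply: pdiv_min_dvd => //; apply: prime_gt1.
  have le_rs : (r <= s.+1)%N by apply: dvdn_leq.
  have : (r == s) || (r == s.+1) by lia.
  case/orP=> /eqP e; first by move: r_s; rewrite e -addn1 dvdn_addr // Euclid_dvd1.
  by have := dvdn_odd r_n n_odd; rewrite e /= s_odd.
- by rewrite divnDl // divnn n_gt0 (divn_small lt_sn); apply: bin_addn_prime_divisor.
Qed.

Import Order.TTheory GRing.Theory Num.Theory.
Local Open Scope ring_scope.

(** * Arithmetic functions *)

Section Arithmetic.
Variable R : realType.
Implicit Types (x n d k m p q : nat) (F G : nat -> R).

Lemma sum_multiples d x F : (0 < d)%N ->
  \sum_(1 <= n < x.+1 | (d %| n)%N) F n = \sum_(1 <= k < (x %/ d).+1) F (d * k)%N.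
Proof.
move=> d_gt0; elim: x => [|x IH]; first by rewrite div0n !big_geq.
rewrite big_mkcond big_nat_recr //= -big_mkcond IH divnS //=.
case: ifP => [dx|_]; last by rewrite addr0.
have e : x.+1 = (d * (x %/ d).+1)%N by rewrite mulnC -{1}(divnK dx) divnS // dx.
rewrite add1n [RHS]big_nat_recr //= -e; congr (_ + _).
Qed.

Lemma sum_divisors_widen x n (G : nat -> R) : (0 < n <= x)%N ->
  \sum_(1 <= d < n.+1 | (d %| n)%N) G d = \sum_(1 <= d < x.+1 | (d %| n)%N) G d.
Proof.
move=> /andP[n_gt0 le_nx]; rewrite [RHS](@big_cat_nat _ _ _ n.+1) //=.
rewrite [X in _ + X]big_nat_cond [X in _ + X]big1 ?addr0 // => d /andP[/andP[lt_nd _]].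
by rewrite gtnNdvd.
Qed.

(** Regrouping by [n = d k]; every convolution identity below is summed over [n <= x] in this
    way. *)
Lemma sum_dirichlet x (F : nat -> nat -> R) :
  \sum_(1 <= n < x.+1) \sum_(1 <= d < n.+1 | (d %| n)%N) F d (n %/ d)%N
  = \sum_(1 <= d < x.+1) \sum_(1 <= k < (x %/ d).+1) F d k.
Proof.
transitivity (\sum_(1 <= n < x.+1) \sum_(1 <= d < x.+1 | (d %| n)%N) F d (n %/ d)%N).
  by apply: eq_big_nat => n n1; apply: sum_divisors_widen.
rewrite (exchange_big_dep_nat xpredT) //=.
apply: eq_big_nat => d /andP[d_gt0 _].
by rewrite sum_multiples //; apply: eq_bigr => k _; rewrite mulKn.
Qed.

Lemma sum_divisors_pmul p m F : prime p -> (0 < m)%N ->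
  \sum_(1 <= d < (p * m).+1 | (d %| p * m)%N) F d =
  \sum_(1 <= d < m.+1 | (d %| m)%N && ~~ (p %| d)%N) F d + \sum_(1 <= d < m.+1 | (d %| m)%N) F
    (p * d)%N.
Proof.
move=> p_pr m_gt0; have p_gt0 := prime_gt0 p_pr.
rewrite (bigID (fun d => (p %| d)%N)) /= addrC; congr (_ + _).
  rewrite (@big_cat_nat _ _ _ m.+1) //=; last by rewrite ltnS leq_pmull.
  rewrite [X in _ + X]big_nat_cond [X in _ + X]big1 ?addr0.
    apply: eq_bigl => d; have [pd|npd] := boolP (p %| d)%N; first by rewrite !andbF.
    by rewrite !andbT Gauss_dvdr // coprime_sym prime_coprime.
  move=> d /andP[/andP[lt_md _] /andP[d_pm npd]].
  by move: d_pm; rewrite Gauss_dvdr ?gtnNdvd // coprime_sym prime_coprime.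
rewrite big_mkcond -big_mkcond /=.
under eq_bigl do rewrite andbC.
rewrite big_mkcondr /= sum_multiples // mulKn // -big_mkcond /=.
by apply: eq_bigl => d; rewrite dvdn_pmul2l.
Qed.

(** * The functions of Moebius and von Mangoldt *)

Definition moebius n : R := \prod_(q <- primes n) (if logn q n == 1%N then -1 else 0).

Lemma moebius1 : moebius 1 = 1.
Proof. by rewrite /moebius big_nil. Qed.

Lemma norm_moebius_le1 n : `|moebius n| <= 1.
Proof.
rewrite /moebius; elim/big_rec: _ => [|q y _ IH]; first by rewrite normr1.
by case: ifP => _; rewrite normrM ?normrN1 ?mul1r // normr0 mul0r.
Qed.

Lemma moebius_pmul p d : prime p -> (0 < d)%N ->
  moebius (p * d) = if (p %| d)%N then 0 else - moebius d.
Proof.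
move=> p_pr d_gt0; have p_gt0 := prime_gt0 p_pr.
have pd_gt0 : (0 < p * d)%N by rewrite muln_gt0 p_gt0.
case: ifP => pd.
  rewrite /moebius (bigD1_seq p) ?primes_uniq ?mem_primes ?p_pr ?pd_gt0 ?dvdn_mulr //=.
  rewrite lognM // logn_prime // eqxx ifN ?mul0r //.
  by rewrite add1n eqSS -lt0n logn_gt0 mem_primes p_pr d_gt0 pd.
have -> : moebius (p * d) = \prod_(q <- p :: primes d) (if logn q (p * d) == 1%N then -1 else 0).
  apply: perm_big; apply: uniq_perm;
    rewrite ?primes_uniq //= ?primes_uniq ?mem_primes ?pd ?andbF //.
  by move=> q; rewrite primesM // primes_prime // !inE.
rewrite big_cons lognM // logn_prime // eqxx lognE p_pr d_gt0 pd /= mulN1r; congr (- _).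
apply: eq_big_seq => q; rewrite mem_primes => /and3P[q_pr _ qd].
rewrite lognM // logn_prime //; case: (q =P p) => [e|//].
by rewrite -e qd in pd.
Qed.

(** For a prime factor [p] of [n], a divisor [d] of [n/p] prime to [p] cancels against [p d]; the
    remaining divisors are divisible by [p^2]. *)
Lemma sum_moebius n : (0 < n)%N ->
  \sum_(1 <= d < n.+1 | (d %| n)%N) moebius d = (n == 1%N)%:R.
Proof.
case: n => [//|[|n]] _; first by rewrite big_mkcond big_nat1 dvd1n moebius1.
set N := n.+2; have p_pr : prime (pdiv N) by apply: pdiv_prime.
have m_gt0 : (0 < N %/ pdiv N)%N by rewrite divn_gt0 ?pdiv_gt0 // dvdn_leq // pdiv_dvd.
rewrite -(divnK (pdiv_dvd N)) mulnC sum_divisors_pmul //.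
rewrite [X in _ + X](_ : _ = - \sum_(1 <= d < (N %/ pdiv N).+1 | (d %| N %/ pdiv N)%N && ~~
  (pdiv N %| d)%N) moebius d).
  rewrite subrr mulnC divnK ?pdiv_dvd //.
rewrite big_mkcondr /= -sumrN big_nat_cond [RHS]big_nat_cond;
  apply: eq_bigr => d /andP[/andP[d_gt0 _] _].
by rewrite moebius_pmul //; case: ifP; rewrite ?oppr0.
Qed.

Definition mangoldt n : R := if primes n is [:: p] then ln p%:R else 0.

Lemma mangoldt_pfactor p k : prime p -> (0 < k)%N -> mangoldt (p ^ k) = ln p%:R.
Proof. by move=> p_pr k_gt0; rewrite /mangoldt primesX // primes_prime. Qed.

Lemma mangoldt_neq0 n : mangoldt n != 0 ->
  exists p k, [/\ prime p, (0 < k)%N & n = (p ^ k)%N].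
Proof.
rewrite /mangoldt; case e: (primes n) => [|p [|? ?]]; rewrite ?eqxx // => _.
have p_n : p \in primes n by rewrite e mem_head.
have n_gt0 : (0 < n)%N by move: p_n; rewrite mem_primes => /and3P[].
have p_pr : prime p by move: p_n; rewrite mem_primes => /and3P[].
exists p, (logn p n); split=> //; first by rewrite logn_gt0.
by rewrite [LHS]prod_prime_decomp // prime_decompE e /= big_cons big_nil muln1.
Qed.

Lemma mangoldt_ge0 n : 0 <= mangoldt n.
Proof.
rewrite /mangoldt; case e: (primes n) => [|p [|? ?]] //.
rewrite ln_ge0 // ler1n; have: p \in primes n by rewrite e mem_head.
by rewrite mem_primes => /and3P[/prime_gt0].
Qed.

(** Passing from [M] to [p M] adds exactly one prime power to the divisors, [p^k] with
    [k = v_p(M) + 1], and it contributes [ln p]. *)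
Lemma sum_mangoldt n : (0 < n)%N ->
  \sum_(1 <= d < n.+1 | (d %| n)%N) mangoldt d = ln n%:R.
Proof.
have [m] := ubnP n; elim: m n => // m IH [//|[|n]] lt_nm _.
  by rewrite big_mkcond big_nat1 dvd1n ln1.
have [p p_pr /dvdnP[M defN]] : exists2 p, prime p & (p %| n.+2)%N.
  by exists (pdiv n.+2); rewrite ?pdiv_prime ?pdiv_dvd.
move: defN lt_nm (isT : (0 < n.+2)%N); move: n.+2 => {n}N; rewrite mulnC => defN lt_nm N_gt0.
have p_gt0 := prime_gt0 p_pr.
have M_gt0 : (0 < M)%N by move: N_gt0; rewrite defN muln_gt0 p_gt0.
have lt_MN : (M < N)%N by rewrite defN ltn_Pmull // prime_gt1.
rewrite (bigID (fun d => (d %| M)%N)) /=.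
rewrite [in RHS]defN natrM lnM ?posrE ?ltr0n // addrC; congr (_ + _); last first.
  rewrite -IH //; last by apply: leq_trans lt_MN _.
  rewrite (sum_divisors_widen (x := N)) ?M_gt0 1?ltnW //.
  by apply: eq_bigl => d; apply/andb_idl => dM; rewrite defN dvdn_mull.
have [k def_k] : exists k, k = (logn p M).+1 by eexists.
have pk_N : (p ^ k %| N)%N by rewrite def_k defN expnS dvdn_pmul2l // pfactor_dvdnn.
have pk_M : ~~ (p ^ k %| M)%N by rewrite def_k pfactor_dvdn // ltnn.
have pk_gt0 : (0 < p ^ k)%N by rewrite expn_gt0 p_gt0.
have pk_in : (p ^ k)%N \in index_iota 1 N.+1 by rewrite mem_index_iota pk_gt0 ltnS
  (dvdn_leq N_gt0 pk_N).
rewrite big_mkcond.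
rewrite (bigD1_seq _ pk_in (iota_uniq _ _)).
rewrite pk_N pk_M /=.
rewrite mangoldt_pfactor ?def_k // big1 ?addr0 // => d dpk; case: ifP => // /andP[dN dM].
apply/eqP; apply: contraNT dpk => /mangoldt_neq0[q [j [q_pr j_gt0 e]]].
move: dN dM; rewrite {}e defN !pfactor_dvdn ?muln_gt0 ?p_gt0 // lognM // logn_prime //.
case: eqP => [->|_] /= h1 h2; last by rewrite h1 in h2.
by apply/eqP; congr (_ ^ _)%N; lia.
Qed.

(** Moebius inversion of [sum_mangoldt]: after exchanging the sums, the Moebius sum over the
    divisors of [n/e] vanishes unless [e = n]. *)
Lemma sum_moebius_ln_div n : (0 < n)%N ->
  \sum_(1 <= d < n.+1 | (d %| n)%N) moebius d * ln (n %/ d)%:R = mangoldt n.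
Proof.
move=> n_gt0.
have div_gt0 d : (d %| n)%N -> (0 < n %/ d <= n)%N.
  by move=> dn; rewrite divn_gt0 ?(dvdn_gt0 n_gt0 dn) // (dvdn_leq n_gt0 dn) leq_div.
have dvdC d e : (d %| n)%N && (e %| n %/ d)%N = (e %| n)%N && (d %| n %/ e)%N.
  apply/andP/andP => -[h]; rewrite dvdn_divRL // => h2.
    have en := dvdn_trans (dvdn_mulr _ (dvdnn e)) h2.
    by rewrite dvdn_divRL // mulnC.
  have en := dvdn_trans (dvdn_mulr _ (dvdnn d)) h2.
  by rewrite dvdn_divRL // mulnC.
transitivity (\sum_(1 <= d < n.+1 | (d %| n)%N) \sum_(1 <= e < n.+1 | (e %| n %/ d)%N)
    moebius d * mangoldt e).
  apply: eq_bigr => d dn; have /andP[nd_gt0 _] := div_gt0 d dn.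
  by rewrite -sum_mangoldt // (@sum_divisors_widen n) ?div_gt0 // mulr_sumr.
rewrite (exchange_big_dep_nat xpredT) //=.
rewrite (bigD1_seq n) /= ?iota_uniq ?mem_index_iota ?n_gt0 ?ltnSn //.
rewrite [X in _ + X]big_nat_cond [X in _ + X]big1 ?addr0 => [|e /andP[/andP[e_gt0 _] en]].
  under eq_bigl do rewrite dvdC dvdnn divnn n_gt0 /=.
  rewrite -(@sum_divisors_widen n 1) //.
  by rewrite big_mkcond big_nat1 dvd1n moebius1 mul1r.
have [e_n|e_n] := boolP (e %| n)%N; last first.
  by rewrite big1 // => d; rewrite dvdC (negPf e_n).
under eq_bigl do rewrite dvdC e_n /=.
rewrite -(@sum_divisors_widen n) ?div_gt0 // -mulr_suml sum_moebius;
  last by case/andP: (div_gt0 e e_n).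
rewrite (_ : (n %/ e == 1)%N = false) ?mul0r //; apply: contraNF en => /eqP ne1.
by rewrite -[X in _ == X](divnK e_n) ne1 mul1n.
Qed.

Lemma sum_moebius_ln y n : (0 < n)%N ->
  \sum_(1 <= d < n.+1 | (d %| n)%N) moebius d * (y - ln d%:R) = (n == 1%N)%:R * y + mangoldt n.
Proof.
move=> n_gt0.
transitivity (\sum_(1 <= d < n.+1 | (d %| n)%N) (moebius d * (y - ln n%:R) + moebius d * ln
  (n %/ d)%:R)).
  rewrite big_nat_cond [RHS]big_nat_cond; apply: eq_bigr => d /andP[/andP[d_gt0 lt_dn] dn].
  have q_gt0 : (0 < n %/ d)%N by rewrite divn_gt0 // dvdn_leq.
  have -> : ln n%:R = ln (n %/ d)%:R + ln d%:R :> R.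
    by rewrite -{1}(divnK dn) natrM lnM ?posrE ?ltr0n.
  by ring.
rewrite big_split /= sum_moebius_ln_div // -mulr_suml sum_moebius //.
by case: eqP => [->|_]; rewrite ?ln1 ?subr0 // !mul0r.
Qed.

Lemma ln_fact_mangoldt x :
  ln (x`!)%:R = \sum_(1 <= d < x.+1) mangoldt d * (x %/ d)%:R.
Proof.
transitivity (\sum_(1 <= n < x.+1) ln n%:R : R).
  elim: x => [|x IH]; first by rewrite big_geq // fact0 ln1.
  by rewrite factS natrM lnM ?posrE ?ltr0n ?fact_gt0 // IH [RHS]big_nat_recr //= addrC.
rewrite -(eq_big_nat _ _ (F1 := fun n => \sum_(1 <= d < n.+1 | (d %| n)%N) mangoldt d)); last first.
  by move=> n /andP[n_gt0 _]; rewrite sum_mangoldt.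
rewrite (sum_dirichlet x (fun d _ => mangoldt d)); apply: eq_bigr => d _.
by rewrite sumr_const_nat subn1 /= mulr_natr.
Qed.

(** A weak form of Stirling's formula; the induction step amounts to [y ln(1 + 1/y) <= 1]. *)
Lemma ln_fact_ge x : x%:R * ln x%:R - x%:R <= ln (x`!)%:R :> R.
Proof.
elim: x => [|x IH]; first by rewrite mul0r subr0 fact0 ln1.
rewrite factS natrM lnM ?posrE ?ltr0n ?fact_gt0 //.
case: x IH => [|x] IH; first by rewrite fact0 ln1 mul1r; lra.
apply: le_trans (lerD (lexx _) IH).
set y : R := x.+1%:R; have y_gt0 : 0 < y by rewrite ltr0n.
have -> : x.+2%:R = y * (1 + y^-1) by rewrite mulrDr mulr1 mulfV ?gt_eqF // -natr1.
have h : 0 < 1 + y^-1 by rewrite addr_gt0 // invr_gt0.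
rewrite lnM ?posrE //.
have hl : ln (1 + y^-1) <= y^-1 by apply: le_ln1Dx;
  rewrite (lt_trans _ (_ : 0 < _)) ?invr_gt0 // oppr_lt0.
have e : y * (1 + y^-1) = y + 1 by rewrite mulrDr mulr1 mulfV ?gt_eqF.
have : y * ln (1 + y^-1) <= 1 by rewrite -[leRHS](@mulfV _ y) ?gt_eqF // ler_pM2l.
rewrite e; lra.
Qed.

Lemma ln_fact_le x : ln (x`!)%:R <= x%:R * ln x%:R :> R.
Proof.
elim: x => [|x IH]; first by rewrite mul0r fact0 ln1.
rewrite factS natrM lnM ?posrE ?ltr0n ?fact_gt0 //.
case: x IH => [|x] IH; first by rewrite fact0 ln1 mul1r addr0.
rewrite [X in _ <= X * _](_ : _ = 1 + x.+1%:R); last by rewrite addrC natr1.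
rewrite mulrDl mul1r lerD2l (le_trans IH) // ler_wpM2l ?ler0n //.
by rewrite ler_ln ?posrE ?ltr0n // ler_nat.
Qed.
End Arithmetic.

(** * Estimates of Chebyshev and Mertens *)

Section Chebyshev.
Variable R : realType.
Implicit Types (x n d k m p q : nat).
Local Notation mangoldt := (@mangoldt R).

Definition chebyshev_psi x : R := \sum_(1 <= d < x.+1) mangoldt d.

Lemma le_chebyshev_psi x n : (x <= n)%N -> chebyshev_psi x <= chebyshev_psi n.
Proof.
move=> le_xn; rewrite /chebyshev_psi [leRHS](@big_cat_nat _ _ _ x.+1) //= lerDl.
by apply: sumr_ge0 => d _; apply: mangoldt_ge0.
Qed.

Lemma bin_le_exp2 n k : ('C(n, k) <= 2 ^ n)%N.
Proof.
elim: n k => [|n IH] [|k] //; first by rewrite bin0 expn_gt0.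
by rewrite binS expnS mul2n -addnn leq_add.
Qed.

Lemma ln2_le1 : ln 2 <= 1 :> R.
Proof. by have := @le_ln1Dx R 1; rewrite -[1 + 1]/(2 : R); apply;
  rewrite (lt_trans (ltrN10 _)). Qed.

(** In [ln C(2m, m)] the weight of [mangoldt d] is [floor(2m/d) - 2 floor(m/d)], which is
    nonnegative and at least 1 for [m < d <= 2m]; and [C(2m, m) <= 2^(2m)]. *)
Lemma chebyshev_psi_double m : chebyshev_psi (2 * m) <= chebyshev_psi m + 2 * m%:R.
Proof.
have lnfm : ln (m`!)%:R = \sum_(1 <= d < (2 * m).+1) mangoldt d * (m %/ d)%:R.
  rewrite ln_fact_mangoldt [RHS](@big_cat_nat _ _ _ m.+1) //=; last by rewrite ltnS leq_pmull.
  rewrite [X in _ + X]big_nat [X in _ + X]big1 ?addr0 // => d /andP[lt_md _].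
  by rewrite divn_small // mulr0.
have bin_ln : ln ((2 * m)`!)%:R = ln 'C(2 * m, m)%:R + 2 * ln (m`!)%:R :> R.
  rewrite -(@bin_fact (2 * m) m) ?leq_pmull // mul2n -addnn addnK !natrM.
  rewrite !lnM ?posrE ?mulr_gt0 ?ltr0n ?fact_gt0 ?bin_gt0 ?leq_addl //.
  by rewrite mulr2n mulrDl mul1r.
have bin_le : ln 'C(2 * m, m)%:R <= 2 * m%:R :> R.
  have b_gt0 : (0 < 'C(2 * m, m))%N by rewrite bin_gt0 leq_pmull.
  apply: (@le_trans _ _ (ln (2 ^+ (2 * m)))).
    by rewrite ler_ln ?posrE ?exprn_gt0 ?ltr0n // -natrX ler_nat bin_le_exp2.
  rewrite lnXn // -[leLHS]mulr_natl natrM -[leRHS]mulr1.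
  by rewrite ler_wpM2l ?mulr_ge0 ?ler0n ?ln2_le1.
rewrite -lerBlDl; apply: le_trans bin_le.
have -> : ln 'C(2 * m, m)%:R = \sum_(1 <= d < (2 * m).+1) mangoldt d * ((2 * m %/ d)%:R - 2 *
  (m %/ d)%:R) :> R.
  under eq_bigr do rewrite mulrBr mulrCA.
  by rewrite sumrB -mulr_sumr -lnfm -ln_fact_mangoldt bin_ln addrK.
rewrite /chebyshev_psi [X in X - _](@big_cat_nat _ _ _ m.+1) //=; last by rewrite ltnS leq_pmull.
rewrite addrAC subrr add0r [leRHS](@big_cat_nat _ _ _ m.+1) //=; last by rewrite ltnS leq_pmull.
rewrite -[leLHS]add0r lerD //.
  rewrite big_nat; apply: sumr_ge0 => d /andP[d_gt0 _].
  rewrite mulr_ge0 ?mangoldt_ge0 // subr_ge0 -natrM ler_nat leq_divRL //.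
  by rewrite -mulnA leq_mul2l leq_trunc_div.
apply: ler_sum_nat => d /andP[lt_md le_dm].
rewrite (divn_small lt_md) mulr0 subr0 ler_peMr ?mangoldt_ge0 // ler1n divn_gt0 //.
by rewrite (leq_trans _ lt_md).
Qed.

Lemma chebyshev_psi_le x : chebyshev_psi x <= 4 * x%:R.
Proof.
have [m] := ubnP x; elim: m x => // m IH x lt_xm.
have psi0 : chebyshev_psi 0 = 0 by rewrite /chebyshev_psi big_geq.
have psi1 : chebyshev_psi 1 = 0 by rewrite /chebyshev_psi big_nat1.
case: x lt_xm => [|[|x]] lt_xm; first by rewrite psi0 mulr0.
  by rewrite psi1 mulr1.
(* Halving upwards leads to [4 h + 2 h = 6 h], which stays below 4 times the argument even after
   rounding. *)
set h := (uphalf x.+2).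
have le_x2h : (x.+2 <= 2 * h)%N by rewrite /h; lia.
have lt_hx : (h < m)%N by rewrite /h; lia.
apply: le_trans (le_chebyshev_psi le_x2h) _.
apply: le_trans (chebyshev_psi_double h) _.
apply: (@le_trans _ _ (4 * h%:R + 2 * h%:R)); first by rewrite lerD2r IH.
rewrite -mulrDl -!natrM -natrD -natrM ler_nat /h; lia.
Qed.

Lemma floor_div_le x d : (0 < d)%N -> (x %/ d)%:R <= x%:R / d%:R :> R.
Proof. by move=> d_gt0; rewrite ler_pdivlMr ?ltr0n // -natrM ler_nat leq_trunc_div. Qed.

Lemma lt_floor_divS x d : (0 < d)%N -> x%:R / d%:R < (x %/ d).+1%:R :> R.
Proof. by move=> d_gt0; rewrite ltr_pdivrMr ?ltr0n // -natrM ltr_nat ltn_ceil. Qed.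

(** Removing the floors in [ln_fact_mangoldt] costs at most [chebyshev_psi x <= 4 x], and [ln x!]
    lies between [x ln x - x] and [x ln x]. *)
Lemma mertens x : (0 < x)%N ->
  `|\sum_(1 <= d < x.+1) mangoldt d / d%:R - ln x%:R| <= 4.
Proof.
move=> x_gt0; set S := \sum_(_ <= _ < _) _; have xr_gt0 : 0 < x%:R :> R by rewrite ltr0n.
have lo : ln (x`!)%:R <= x%:R * S.
  rewrite ln_fact_mangoldt mulr_sumr; apply: ler_sum_nat => d /andP[d_gt0 _].
  by rewrite mulrCA ler_wpM2l ?mangoldt_ge0 // floor_div_le.
have hi : x%:R * S <= ln (x`!)%:R + chebyshev_psi x.
  rewrite ln_fact_mangoldt -big_split mulr_sumr /=.
  apply: ler_sum_nat => d /andP[d_gt0 _].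
  rewrite mulrCA -[X in _ <= _ + X]mulr1 -mulrDr ler_wpM2l ?mangoldt_ge0 // natr1.
  exact/ltW/lt_floor_divS.
have h1 := ln_fact_ge R x; have h2 := ln_fact_le R x; have h3 := chebyshev_psi_le x.
rewrite ler_norml; apply/andP; split; rewrite -(ler_pM2l xr_gt0) mulrBr; lra.
Qed.

Lemma sum_geom_le (r : R) n : 0 <= r < 1 -> \sum_(2 <= k < n) r ^+ k <= r ^+ 2 / (1 - r).
Proof.
move=> /andP[r_ge0 r_lt1]; have r1 : 0 < 1 - r by rewrite subr_gt0.
rewrite ler_pdivlMr //.
have [le_n2|lt_2n] := leqP n 2; first by rewrite big_geq // mul0r exprn_ge0.
suff -> : (\sum_(2 <= k < n) r ^+ k) * (1 - r) = r ^+ 2 - r ^+ n by rewrite lerBlDr lerDl exprn_ge0.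
elim: n lt_2n => // n IH; rewrite ltnS leq_eqVlt => /orP[/eqP <-|lt_2n].
  by rewrite big_nat1 !exprS; ring.
by rewrite big_nat_recr 1?ltnW //= mulrDl IH // [r ^+ n.+1]exprS; ring.
Qed.

Lemma sum_ln_div_le x : \sum_(2 <= m < x.+1) ln m%:R / (m%:R * (m%:R - 1)) <= 2 :> R.
Proof.
case: x => [|x]; first by rewrite big_geq.
(* The bound is strengthened so that induction applies; the step reduces to
   [(y + 1) (ln(y + 1) - ln y) <= 2]. *)
suff : \sum_(2 <= m < x.+2) ln m%:R / (m%:R * (m%:R - 1)) <= 2 - (2 + ln x.+1%:R) / x.+1%:R :> R.
  move=> h; apply: le_trans h _; rewrite lerBlDr lerDl divr_ge0 ?addr_ge0 //.
  by rewrite ln_ge0 // ler1n.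
elim: x => [|x IH]; first by rewrite big_geq // ln1; lra.
rewrite big_nat_recr //=; apply: le_trans (lerD IH (lexx _)) _.
set y : R := x.+1%:R; have y_gt0 : 0 < y by rewrite ltr0n.
have -> : x.+2%:R = y + 1 by rewrite natr1.
have y1_gt0 : 0 < y + 1 by lra.
have hl : ln (y + 1) <= ln y + y^-1.
  have -> : y + 1 = y * (1 + y^-1) by field; lra.
  rewrite lnM ?posrE ?addr_gt0 ?invr_gt0 // lerD2l le_ln1Dx //.
  by rewrite (lt_trans (ltrN10 _)) // invr_gt0.
have ey : ln y <= y - 1 by have := @le_ln1Dx R (y - 1); rewrite (_ : 1 + (y - 1) = y); [apply;
  lra | ring].
have y_ge1 : 1 <= y by rewrite ler1n.
rewrite -subr_ge0.
have -> : 2 - (2 + ln (y + 1)) / (y + 1) - (2 - (2 + ln y) / y + ln (y + 1) / ((y + 1) *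
  (y + 1 - 1))) =
  (2 - (y + 1) * (ln (y + 1) - ln y)) / (y * (y + 1)) by field; lra.
rewrite divr_ge0 ?mulr_ge0 ?(ltW y_gt0) ?(ltW y1_gt0) // subr_ge0.
apply: (@le_trans _ _ ((y + 1) * y^-1)); first by rewrite ler_pM2l // lerBlDl.
by rewrite ler_pdivrMr //; lra.
Qed.

Lemma sum_mangoldt_nonprime x :
  \sum_(1 <= n < x.+1 | ~~ prime n) mangoldt n / n%:R <= 2.
Proof.
pose T p k : R := ln p%:R / p%:R ^+ k.
have T_ge0 p k : (1 < p)%N -> 0 <= T p k.
  by move=> p_gt1; rewrite divr_ge0 ?exprn_ge0 // ln_ge0 // ler1n ltnW.
(* Each proper prime power is charged to its pair [(p, k)] with [k >= 2]; letting [p] run over all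
   integers from 2 on only enlarges the sum, and the geometric series in [k] gives
   [ln p / (p (p - 1))]. *)
apply: (@le_trans _ _ (\sum_(1 <= n < x.+1) \sum_(2 <= p < x.+1) \sum_(2 <= k < x.+1)
   if (p ^ k == n)%N then T p k else 0)).
  rewrite big_mkcond; apply: ler_sum_nat => n /andP[n_gt0 lt_nx].
  have S_ge0 : 0 <= \sum_(2 <= p < x.+1) \sum_(2 <= k < x.+1) if (p ^ k == n)%N then T p k else 0.
    rewrite big_nat; apply: sumr_ge0 => p /andP[p_gt1 _]; apply: sumr_ge0 => k _.
    by case: ifP => // _; apply: T_ge0.
  case: ifP => // n_npr; have [->|/mangoldt_neq0] := eqVneq (mangoldt n) 0; first by rewrite mul0r.
  case=> p [k [p_pr k_gt0 def_n]].
  have k_gt1 : (1 < k)%N.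
    by case: k k_gt0 def_n => [|[|k]] // _ def_n; rewrite def_n expn1 p_pr in n_npr.
  have p_gt1 := prime_gt1 p_pr.
  have lt_kx : (k < x.+1)%N by rewrite (leq_trans _ lt_nx) // def_n ltnW // ltnS ltn_expl.
  have lt_px : (p < x.+1)%N.
    by rewrite (leq_ltn_trans _ lt_nx) // def_n -{1}(expn1 p) leq_pexp2l // ltnW.
  rewrite (bigD1_seq p) /= ?iota_uniq ?mem_index_iota ?p_gt1 //.
  rewrite (bigD1_seq k) /= ?iota_uniq ?mem_index_iota ?k_gt1 //.
  rewrite def_n eqxx mangoldt_pfactor // natrX -[leLHS]addr0 -addrA lerD // -def_n addr_ge0 //.
    rewrite big_nat_cond; apply: sumr_ge0 => j _; case: ifP => // _; exact: T_ge0.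
  rewrite big_nat_cond; apply: sumr_ge0 => q /andP[/andP[q_gt1 _] _].
  by apply: sumr_ge0 => j _; case: ifP => // _; apply: T_ge0.
apply: le_trans (sum_ln_div_le x).
rewrite exchange_big_nat /=; apply: ler_sum_nat => p /andP[p_gt1 _].
rewrite exchange_big_nat /=.
have pr_gt1 : 1 < p%:R :> R by rewrite ltr1n.
have lnp : 0 <= ln p%:R :> R by rewrite ln_ge0 // ltW.
have -> : ln p%:R / (p%:R * (p%:R - 1)) = ln p%:R * (p%:R^-1 ^+ 2 /
  (1 - p%:R^-1)) :> R by field; repeat (apply/andP; split); lra.
apply: le_trans (ler_wpM2l lnp (@sum_geom_le p%:R^-1 x.+1 _)); last first.
  by rewrite invr_ge0 ler0n /= invf_lt1 // ltr0n ltnW.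
rewrite mulr_sumr; apply: ler_sum => k _; rewrite -big_mkcond /= exprVn -/(T p k).
under eq_bigl do rewrite eq_sym.
by rewrite big_nat1_eq; case: ifP => // _; apply: T_ge0.
Qed.

(** The bound is independent of [x]: a class of integers containing only finitely many primes has
    bounded weight. It serves both to discard integers without a class and to reach the
    contradiction in Dirichlet's theorem. *)
Lemma sum_mangoldt_few_primes (P : pred nat) m x : (forall p, P p -> prime p -> (p <= m)%N) ->
  \sum_(1 <= d < x.+1 | P d) mangoldt d / d%:R <= \sum_(1 <= d < m.+1) mangoldt d / d%:R + 2.
Proof.
move=> Pm; have t_ge0 d : 0 <= mangoldt d / d%:R by rewrite divr_ge0 ?mangoldt_ge0.
apply: (@le_trans _ _ (\sum_(1 <= d < x.+1) ((if (d < m.+1)%N then mangoldt d / d%:R else 0) +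
     (if ~~ prime d then mangoldt d / d%:R else 0)))).
  rewrite big_mkcond; apply: ler_sum => d _; case: ifP => [Pd|_]; last first.
    by rewrite addr_ge0 //; case: ifP.
  have [p_d|_] := boolP (prime d); last by rewrite lerDr; case: ifP.
  by rewrite ltnS Pm // addr0.
rewrite big_split /= lerD //; last by rewrite -big_mkcond; apply: sum_mangoldt_nonprime.
have [le_mx|lt_xm] := leqP m.+1 x.+1.
  rewrite (@big_cat_nat _ _ _ m.+1) //= [X in _ + X]big_nat [X in _ + X]big1 ?addr0.
    by apply: ler_sum_nat => d /andP[_ ->].
  by move=> d /andP[le_md _]; rewrite ltnNge le_md.
rewrite [leRHS](@big_cat_nat _ _ _ x.+1) ?(ltnW lt_xm) //=.
apply: ler_wpDr; first by apply: sumr_ge0.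
by apply: ler_sum => d _; case: ifP.
Qed.
End Chebyshev.

(** * Dirichlet's test *)

Section DirichletTest.
Variable R : realType.
Implicit Types (a f : nat -> R) (A : R).

Definition bounded_sums a A := forall m n, `|\sum_(m <= i < n) a i| <= A.

Lemma dirichlet_test a f A m n : bounded_sums a A ->
  (forall i, (m <= i)%N -> 0 <= f i) -> (forall i, (m <= i)%N -> f i.+1 <= f i) ->
  `|\sum_(m <= i < n) a i * f i| <= A * f m.
Proof.
move=> aA f_ge0 f_dec; have A_ge0 : 0 <= A by apply: le_trans (aA 0 0)%N.
have [le_nm|/ltnW le_mn] := leqP n m; first by rewrite big_geq // normr0 mulr_ge0 ?f_ge0.
(* Abel summation, with the boundary term kept apart so that the bound telescopes. *)
suff h : `|\sum_(m <= i < n) a i * f i - (\sum_(m <= i < n) a i) * f n| <= A * (f m - f n).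
  rewrite -[X in `|X|](subrK ((\sum_(m <= i < n) a i) * f n)).
  apply: le_trans (ler_normD _ _) _.
  have h2 : `|(\sum_(m <= i < n) a i) * f n| <= A * f n.
    by rewrite normrM [X in _ * X]ger0_norm ?f_ge0 // ler_wpM2r ?f_ge0.
  by apply: le_trans (lerD h h2) _; rewrite -mulrDr subrK.
rewrite -(subnKC le_mn); elim: (n - m)%N => [|k IH].
  by rewrite addn0 !big_geq // mul0r subrr normr0 subrr mulr0.
rewrite addnS !big_nat_recr ?leq_addr //=; set j := (m + k)%N in IH *.
have le_mj : (m <= j)%N by rewrite leq_addr.
set S := \sum_(m <= i < j) a i * f i in IH *.
have -> : S + a j * f j - ((\sum_(m <= i < j) a i) + a j) * f j.+1 =
   (S - (\sum_(m <= i < j) a i) * f j) + (\sum_(m <= i < j.+1) a i) * (f j - f j.+1).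
  by rewrite big_nat_recr //=; ring.
apply: le_trans (ler_normD _ _) _.
have -> : A * (f m - f j.+1) = A * (f m - f j) + A * (f j - f j.+1) by ring.
apply: lerD => //; rewrite normrM [X in _ * X]ger0_norm ?subr_ge0 ?f_dec //.
by rewrite ler_wpM2r ?subr_ge0 ?f_dec.
Qed.

Lemma inv_nat_decr i : (0 < i)%N -> i.+1%:R^-1 <= i%:R^-1 :> R.
Proof. by move=> i_gt0; rewrite lef_pV2 ?posrE ?ltr0n // ler_nat. Qed.

Lemma harmonic_tail a A m n : bounded_sums a A -> (0 < m)%N ->
  `|\sum_(m <= i < n) a i / i%:R| <= A / m%:R.
Proof.
move=> aA m_gt0; apply: (dirichlet_test (f := fun i => i%:R^-1)) => [//|i _|i le_mi];
  first by rewrite invr_ge0.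
by rewrite inv_nat_decr // (leq_trans m_gt0).
Qed.

(** The intervals of radius [A/(x+1)] around the partial sums meet pairwise, so the supremum of
    their left ends lies in all of them. *)
Lemma harmonic_limit a A : bounded_sums a A ->
  exists L, forall x, `|\sum_(1 <= i < x.+1) a i / i%:R - L| <= A / x.+1%:R.
Proof.
move=> aA; pose S x := \sum_(1 <= i < x.+1) a i / i%:R.
have A_ge0 : 0 <= A by apply: le_trans (aA 0 0)%N.
have cauchy x y : (x <= y)%N -> `|S y - S x| <= A / x.+1%:R.
  move=> le_xy; rewrite /S (@big_cat_nat _ _ _ x.+1) //= addrAC subrr add0r.
  exact: harmonic_tail.
have err_ge0 x : 0 <= A / x.+1%:R by rewrite divr_ge0.
have nested x y : S x - A / x.+1%:R <= S y + A / y.+1%:R.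
  have [le|/ltnW le] := leqP x y; move: (cauchy _ _ le) (err_ge0 x) (err_ge0 y);
    rewrite ler_norml => /andP[]; move: (S x) (S y) (A / _) (A / _) => *; lra.
exists (sup (range (fun x => S x - A / x.+1%:R))) => x.
rewrite -/(S x) ler_norml; apply/andP; split.
  rewrite lerNl opprB lerBlDl.
  apply: ge_sup; first by exists (S 0%N - A / 1%:R), 0%N.
  by move=> _ [y _ <-].
rewrite lerBlDr addrC -lerBlDr.
apply: ub_le_sup; last by exists x.
by exists (S 0%N + A / 1%:R) => _ [y _ <-].
Qed.

Lemma bounded_sum_ln a A : bounded_sums a A ->
  forall x, `|\sum_(1 <= i < x.+1) a i * ln i%:R / i%:R| <= 2 * A.
Proof.
move=> aA x; pose f (i : nat) : R := (1 + ln i%:R) / i%:R.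
have f_dec i : (1 <= i)%N -> f i.+1 <= f i.
  move=> i_gt0; set y : R := i%:R; have y_gt0 : 0 < y by rewrite ltr0n.
  have y1_gt0 : 0 < y + 1 by rewrite addr_gt0.
  have lny_ge0 : 0 <= ln y by rewrite ln_ge0 // ler1n.
  have hl : ln (y + 1) <= ln y + y^-1.
    have -> : y + 1 = y * (1 + y^-1) by rewrite mulrDr mulfV ?gt_eqF // mulr1.
    rewrite lnM ?posrE ?addr_gt0 ?invr_gt0 // lerD2l le_ln1Dx //.
    by rewrite (lt_trans (ltrN10 _)) // invr_gt0.
  rewrite /f -natr1 -/y ler_pdivrMr // mulrAC ler_pdivlMr //.
  apply: (@le_trans _ _ ((1 + (ln y + y^-1)) * y)); first by rewrite ler_pM2r // lerD2l.
  by rewrite addrA mulrDl mulVf ?gt_eqF //; lra.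
have f_ge0 i : (1 <= i)%N -> 0 <= f i.
  by move=> i_gt0; rewrite divr_ge0 // addr_ge0 // ln_ge0 // ler1n.
have h1 := @dirichlet_test a f A 1 x.+1 aA f_ge0 f_dec.
have h2 := @harmonic_tail a A 1 x.+1 aA isT.
have -> : \sum_(1 <= i < x.+1) a i * ln i%:R / i%:R =
   \sum_(1 <= i < x.+1) a i * f i - \sum_(1 <= i < x.+1) a i / i%:R.
  by rewrite -sumrB; apply: eq_bigr => i _; rewrite /f; ring.
apply: le_trans (ler_normB _ _) _; move: h1 h2; rewrite /f ln1 addr0 invr1 !mulr1; lra.
Qed.
End DirichletTest.

(** * Orthogonal projection *)

Lemma mulmx_tr_eq0 (F : realFieldType) m n (A : 'M[F]_(m, n)) : A *m A^T = 0 -> A = 0.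
Proof.
move=> A0; apply/matrixP => i j; rewrite mxE; apply/eqP; rewrite -sqrf_eq0.
have /matrixP/(_ i i) := A0; rewrite !mxE => /eqP.
rewrite psumr_eq0 => [/allP/(_ j (mem_index_enum _))|k _]; rewrite mxE -expr2 ?sqr_ge0 //.
Qed.

(** Solvability of the normal equations: [A A^T] has the same left kernel as [A], hence the rank and
    the row space of [A^T]. *)
Lemma orthogonal_projection (F : realFieldType) m n (A : 'M[F]_(m, n)) (u : 'rV_n) :
  exists w, (u - w *m A) *m A^T = 0.
Proof.
have sub : (A *m A^T <= A^T)%MS by apply: submxMl.
have ker : (kermx (A *m A^T) <= kermx A)%MS.
  apply/sub_kermxP/mulmx_tr_eq0; rewrite trmx_mul mulmxA -[_ *m A *m A^T]mulmxA.
  by rewrite mulmx_ker mul0mx.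
have rk : \rank (A *m A^T) = \rank A^T.
  apply/eqP; rewrite eqn_leq mxrankS //= mxrank_tr.
  have := mxrankS ker; rewrite !mxrank_ker.
  by have := rank_leq_row A; have := rank_leq_row (A *m A^T); lia.
have /submxP[w hw] : (u *m A^T <= A *m A^T)%MS.
  apply: submx_trans (submxMl _ _) _.
  by have := mxrank_leqif_sup sub => -[_ <-]; rewrite rk.
by exists w; rewrite mulmxBl -mulmxA hw subrr.
Qed.

Lemma orthogonal_decomposition (F : realFieldType) (I : finType) (T : I -> I -> F) (u : I -> F) :
  exists w, exists e, (forall k, u k = \sum_h w h * T h k + e k) /\
    forall h, \sum_k T h k * e k = 0.
Proof.
pose A := \matrix_(i < #|I|, j < #|I|) T (enum_val i) (enum_val j).
have [w hw] := orthogonal_projection A (\row_j u (enum_val j)).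
have sumE (f : I -> F) : \sum_k f k = \sum_(i < #|I|) f (enum_val i).
  by rewrite -big_enum_val.
pose e k := u k - \sum_h w 0 (enum_rank h) * T h k.
exists (fun h => w 0 (enum_rank h)), e; split=> [k|h]; first by rewrite /e addrC subrK.
have /matrixP/(_ 0 (enum_rank h)) := hw; rewrite !mxE => h0.
rewrite -[RHS]h0 sumE; apply: eq_bigr => j _; rewrite !mxE enum_rankK mulrC; congr (_ * _).
rewrite /e sumE; congr (_ - _); apply: eq_bigr => i _.
by rewrite !mxE enum_valK.
Qed.

(** * Nonvanishing for real characters *)

Section CharacterSums.
Variables (R : realType) (X : nat -> R).
Hypothesis X1 : X 1 = 1.
Hypothesis XM : forall m n, X (m * n) = X m * X n.
Hypothesis X_range : forall n, [\/ X n = 1, X n = 0 | X n = -1].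
Let r n := \sum_(1 <= d < n.+1 | (d %| n)%N) X d.

Lemma norm_char_le1 n : `|X n| <= 1.
Proof. by case: (X_range n) => ->; rewrite ?normrN ?normr0 ?normr1. Qed.

Lemma sum_char_pfactor p a m : prime p -> (0 < m)%N -> ~~ (p %| m)%N ->
  r (p ^ a * m) = (\sum_(i < a.+1) X p ^+ i) * r m.
Proof.
move=> p_pr m_gt0 npm; elim: a => [|a IH]; first by rewrite mul1n big_ord1 expr0 mul1r.
have n_gt0 : (0 < p ^ a * m)%N by rewrite muln_gt0 expn_gt0 prime_gt0.
rewrite expnS -mulnA /r sum_divisors_pmul // -/(r _).
under [X in _ + X]eq_bigr do rewrite XM.
rewrite -mulr_sumr -/(r _) IH [in RHS]big_ord_recl expr0 mulrDl mul1r; congr (_ + _); last first.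
  by rewrite mulrA; congr (_ * _); rewrite mulr_sumr; apply: eq_bigr => i _; rewrite -exprS.
rewrite /r (@sum_divisors_widen R (p ^ a * m) m) ?m_gt0 ?leq_pmull ?expn_gt0 ?prime_gt0 //.
apply: eq_bigl => d; have [pd|npd] := boolP (p %| d)%N; last first.
  by rewrite andbT Gauss_dvdr // coprime_sym coprimeXl // prime_coprime.
by rewrite andbF; apply/esym; apply: contraNF npm; apply: dvdn_trans.
Qed.

Lemma geom_char_ge p a : 0 <= \sum_(i < a.+1) X p ^+ i /\ (~~ odd a -> 1
  <= \sum_(i < a.+1) X p ^+ i).
Proof.
have [Xp_ge0|Xp] : 0 <= X p \/ X p = -1 by case: (X_range p) => ->; [left|left|right].
  have h : 1 <= \sum_(i < a.+1) X p ^+ i.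
    by rewrite big_ord_recl expr0 lerDl sumr_ge0 // => i _; rewrite exprn_ge0.
  by split=> // ; apply: le_trans h.
rewrite Xp; have -> : \sum_(i < a.+1) (-1) ^+ i = (~~ odd a)%:R :> R.
  elim: a => [|a IH]; first by rewrite big_ord1.
  by rewrite big_ord_recr /= IH -signr_odd /=; case: (odd a); rewrite ?expr0 ?expr1 ?add0r ?subrr.
by split=> [|->].
Qed.

(** The divisor sum is multiplicative. Each prime power contributes a nonnegative factor, at least 1
    when the exponent is even, as it is in a square. *)
Lemma sum_char_ge n : (0 < n)%N -> 0 <= r n /\ ((exists j, n = (j ^ 2)%N) -> 1 <= r n).
Proof.
have [b] := ubnP n; elim: b n => // b IH [//|[|n]] lt_nb _.
  have -> : r 1 = 1 by rewrite /r big_mkcond big_nat1 dvdnn.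
  by [].
have [p p_pr p_N] : exists2 p, prime p & (p %| n.+2)%N.
  by exists (pdiv n.+2); rewrite ?pdiv_prime ?pdiv_dvd.
move: p_N lt_nb (isT : (0 < n.+2)%N); move: n.+2 => {n}N p_N lt_nb N_gt0.
have [m npm defN] := pfactor_coprime p_pr N_gt0.
have p_gt0 := prime_gt0 p_pr.
have m_gt0 : (0 < m)%N by move: N_gt0; rewrite defN muln_gt0 => /andP[].
have a_gt0 : (0 < logn p N)%N by rewrite logn_gt0 mem_primes p_pr N_gt0.
have lt_mN : (m < N)%N by rewrite defN ltn_Pmulr // -(exp1n (logn p N)) ltn_exp2r // prime_gt1.
have [rm_ge0 rm_sq] := IH m (leq_trans lt_mN lt_nb) m_gt0.
have [g_ge0 g_ge1] := geom_char_ge p (logn p N).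
have rN : r N = (\sum_(i < (logn p N).+1) X p ^+ i) * r m.
  by rewrite {1}defN mulnC sum_char_pfactor // -prime_coprime.
rewrite rN; split=> [|[j defj]]; first exact: mulr_ge0.
have j_gt0 : (0 < j)%N by move: N_gt0; rewrite defj expn_gt0 orbF.
have [j' _ def_j'] := pfactor_coprime p_pr j_gt0.
have logN : logn p N = (2 * logn p j)%N by rewrite defj lognX.
rewrite -[leLHS]mulr1 ler_pM //; first by apply: g_ge1; rewrite logN mul2n odd_double.
apply: rm_sq; exists j'; apply/eqP.
have defN' : N = (j' ^ 2 * p ^ logn p N)%N.
  by rewrite logN [(2 * _)%N]mulnC expnM -expnMn -def_j'.
by rewrite -(@eqn_pmul2r (p ^ logn p N)) ?expn_gt0 ?p_gt0 // -defN -defN'.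
Qed.
End CharacterSums.

(** * Monotonicity of the Lambert weights *)

Section LambertWeights.
Variables (R : realFieldType) (s : R).
Hypothesis s_int : 0 < s < 1.
Let t := s ^+ 2.

(** This is [(1 - t^n)/(1 - t)]. Writing [t] as the square of [s] makes the geometric mean of its
    terms, [s^(n-1)], available without roots. *)
Definition geom n := \sum_(i < n) t ^+ i.

Let s_gt0 : 0 < s. Proof. by case/andP: s_int. Qed.
Let t_gt0 : 0 < t. Proof. exact: exprn_gt0. Qed.
Let t_lt1 : t < 1. Proof. by rewrite exprn_ilt1 ?ltW //; case/andP: s_int. Qed.

Lemma geomSl n : geom n.+1 = 1 + t * geom n.
Proof.
rewrite /geom big_ord_recl expr0 mulr_sumr; congr (_ + _).
by apply: eq_bigr => i _; rewrite -exprS.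
Qed.

Lemma geomSr n : geom n.+1 = geom n + t ^+ n.
Proof. by rewrite /geom big_ord_recr. Qed.

Lemma geom_ge1 n : 1 <= geom n.+1.
Proof.
rewrite geomSl lerDl mulr_ge0 ?(ltW t_gt0) //; apply: sumr_ge0 => i _.
by rewrite exprn_ge0 // ltW.
Qed.

(* AM-GM on the symmetric pairs of terms of the geometric sum *)
Lemma geom_ge n : n.+1%:R * s ^+ n <= geom n.+1 /\ n.+2%:R * s ^+ n.+1 <= geom n.+2.
Proof.
elim: n => [|n [IH1 IH2]].
  rewrite /geom big_ord1 big_ord_recl big_ord1 /= /bump /= addn0 !expr0 mul1r expr1; split=> //.
  by rewrite -subr_ge0 (_ : _ - _ = (1 - s) ^+ 2) ?sqr_ge0 // /t; ring.
split=> //; rewrite geomSr geomSl.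
(* The outer terms 1 and [t^(n+2)] add up to at least [2 s^(n+2)]; the inner ones form [t] times the
   sum two steps back, which is why two cases are carried. *)
apply: (@le_trans _ _ (2 * s ^+ n.+2 + t * (n.+1%:R * s ^+ n))).
  have -> : n.+3%:R = 2 + n.+1%:R :> R by rewrite -natrD.
  by rewrite le_eqVlt; apply/orP; left; apply/eqP; rewrite /t !exprS; ring.
have h : t * (n.+1%:R * s ^+ n) <= t * geom n.+1 by rewrite ler_pM2l.
have : 0 <= (1 - s ^+ n.+2) ^+ 2 by apply: sqr_ge0.
have -> : (1 - s ^+ n.+2) ^+ 2 = 1 - 2 * s ^+ n.+2 + t ^+ n.+2 by rewrite /t -!exprM mulnC exprM;
  ring.
lra.
Qed.

(* [(1 - t)] times Monsky's weight [1/(n (1 - t)) - t^n/(1 - t^n)] *)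
Definition lambert_gap n := n%:R^-1 - t ^+ n / geom n.

Lemma lambert_gap1 : lambert_gap 1 = 1 - t.
Proof. by rewrite /lambert_gap /geom big_ord1 expr0 expr1 divr1 invr1. Qed.

Lemma lambert_gap_ge0 n : (0 < n)%N -> 0 <= lambert_gap n.
Proof.
case: n => // n _; rewrite subr_ge0 ler_pdivrMr ?(lt_le_trans _ (geom_ge1 n)) //.
rewrite ler_pdivlMl ?ltr0n // /geom.
rewrite (_ : n.+1%:R * _ = \sum_(i < n.+1) t ^+ n.+1);
  last by rewrite sumr_const card_ord mulr_natl.
by apply: ler_sum => i _; rewrite ler_wiXn2l ?(ltW t_gt0) ?(ltW t_lt1) // ltnW.
Qed.

(** The difference is [1/(n(n+1)) - t^n/(geom n geom (n+1))], and [geom_ge] bounds the product of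
    geometric sums below by [n(n+1) s^(2n-1)]. *)
Lemma lambert_gap_decr n : (0 < n)%N -> lambert_gap n.+1 <= lambert_gap n.
Proof.
case: n => // n _; have g1 := geom_ge1 n; have g2 := geom_ge1 n.+1.
have g1p : 0 < geom n.+1 by apply: lt_le_trans g1.
have g2p : 0 < geom n.+2 by apply: lt_le_trans g2.
have np : 0 < n.+1%:R :> R by rewrite ltr0n.
have np2 : 0 < n.+2%:R :> R by rewrite ltr0n.
rewrite -subr_ge0.
have -> : lambert_gap n.+1 - lambert_gap n.+2 =
  (n.+1%:R * n.+2%:R)^-1 - t ^+ n.+1 / (geom n.+1 * geom n.+2).
  rewrite /lambert_gap [t ^+ n.+2]exprS.
  have e : t * geom n.+1 = geom n.+2 - 1 by rewrite [geom n.+2]geomSl; ring.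
  have -> : t * t ^+ n.+1 / geom n.+2 = t ^+ n.+1 * (geom n.+2 - 1) / (geom n.+1 * geom n.+2).
    by rewrite -e; field; rewrite !gt_eqF.
  have e2 : n.+2%:R = n.+1%:R + 1 :> R by rewrite natr1.
  by move: np np2; rewrite e2; move: n.+1%:R (t ^+ _) => y z np np2; field; rewrite !gt_eqF.
rewrite subr_ge0 ler_pdivrMr ?mulr_gt0 // ler_pdivlMl ?mulr_gt0 //.
have [h1 h2] := geom_ge n.
have a1 : 0 <= n.+1%:R * s ^+ n by rewrite mulr_ge0 ?exprn_ge0 ?ltW.
have a2 : 0 <= n.+2%:R * s ^+ n.+1 by rewrite mulr_ge0 ?exprn_ge0 ?ltW.
apply: le_trans (ler_pM a1 a2 h1 h2).
have c_gt0 : 0 < n.+1%:R * n.+2%:R :> R := mulr_gt0 np np2.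
rewrite mulrACA (ler_pM2l c_gt0) /t -exprM -exprD.
by apply: ler_wiXn2l; [apply: ltW | apply: ltW; case/andP: s_int | rewrite mul2n -addnn leq_add2r].
Qed.
End LambertWeights.

(** * Monsky's argument *)

Section NonVanishing.
Variables (R : realType) (X : nat -> R) (A : R).
Hypothesis X1 : X 1 = 1.
Hypothesis XM : forall m n, X (m * n) = X m * X n.
Hypothesis X_range : forall n, [\/ X n = 1, X n = 0 | X n = -1].
Hypothesis X_bounded : bounded_sums X A.
Hypothesis X_lim0 : forall x, `|\sum_(1 <= n < x.+1) X n / n%:R| <= A / x.+1%:R.

Let A_ge0 : 0 <= A. Proof. exact: le_trans (X_bounded 0 0)%N. Qed.

(** The left side is [1 - t] times the truncated Lambert series. Its weights are [1/n] minus
    [lambert_gap]: the first part is small as the L-value is 0, the second falls under Dirichlet's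
    test with initial weight [1 - t]. *)
Lemma lambert_upper s M : 0 < s < 1 ->
  \sum_(1 <= n < M.+1) X n * ((s ^+ 2) ^+ n / geom s n) <= A * (1 - s ^+ 2) + A / M.+1%:R.
Proof.
move=> s_int.
have h := @dirichlet_test _ X (lambert_gap s) A 1 M.+1 X_bounded (@lambert_gap_ge0 _ _ s_int)
  (@lambert_gap_decr _ _ s_int).
rewrite lambert_gap1 in h.
have h2 := X_lim0 M.
have -> : \sum_(1 <= n < M.+1) X n * ((s ^+ 2) ^+ n / geom s n) =
   \sum_(1 <= n < M.+1) X n / n%:R - \sum_(1 <= n < M.+1) X n * lambert_gap s n.
  by rewrite -sumrB; apply: eq_bigr => n _; rewrite /lambert_gap; ring.
apply: le_trans (ler_norm _) _; apply: le_trans (ler_normB _ _) _.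
by rewrite addrC lerD.
Qed.

(** Expanded as a power series in [t], the Lambert series has the divisor sums of [X] as
    coefficients; each of the squares of [1, ..., J] contributes at least [t^(J^2)]. *)
Lemma lambert_lower s M J : 0 < s < 1 -> (J ^ 2 <= M)%N ->
  (1 - s ^+ 2) * (J%:R * (s ^+ 2) ^+ (J ^ 2)) - M%:R * s ^+ M <=
  \sum_(1 <= n < M.+1) X n * ((s ^+ 2) ^+ n / geom s n).
Proof.
move=> s_int le_JM; set t := s ^+ 2; have /andP[s_gt0 s_lt1] := s_int.
have t_gt0 : 0 < t by apply: exprn_gt0.
have t_lt1 : t < 1 by rewrite exprn_ilt1 ?ltW.
have le_ts : t <= s by rewrite /t expr2 ler_piMr // ltW.
pose r n := \sum_(1 <= d < n.+1 | (d %| n)%N) X d.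
have main : J%:R * t ^+ (J ^ 2) <= \sum_(1 <= m < M.+1) r m * t ^+ m.
  have r_ge m : (0 < m)%N -> 0 <= r m /\ ((exists j, m = (j ^ 2)%N) -> 1 <= r m).
    exact: sum_char_ge.
  apply: (@le_trans _ _ (\sum_(1 <= m < M.+1) \sum_(1 <= j < J.+1) if
    (m == j ^ 2)%N then t ^+ m else 0)).
    rewrite exchange_big_nat /=.
    have -> : J%:R * t ^+ (J ^ 2) = \sum_(1 <= j < J.+1) t ^+ (J ^ 2).
      by rewrite sumr_const_nat subn1 mulr_natl.
    apply: ler_sum_nat => j /andP[j_gt0 lt_jJ].
    have le_jJ : (j ^ 2 <= J ^ 2)%N by rewrite leq_exp2r.
    rewrite -big_mkcond big_nat1_eq expn_gt0 j_gt0 /= ltnS (leq_trans le_jJ le_JM).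
    by rewrite ler_wiXn2l ?ltW.
  apply: ler_sum_nat => m /andP[m_gt0 _]; have [r_ge0 r_ge1] := r_ge m m_gt0.
  have tm_ge0 : 0 <= t ^+ m by rewrite exprn_ge0 ?ltW.
  case: (boolP [exists j : 'I_J.+1, m == (j ^ 2)%N]) => [/existsP[j /eqP mj]|nex].
    have j_gt0 : (0 < j)%N by move: m_gt0; rewrite mj expn_gt0 orbF.
    rewrite (bigD1_seq (nat_of_ord j)) ?iota_uniq ?mem_index_iota ?j_gt0 ?ltn_ord
      //= mj eqxx big1 ?addr0.
      by rewrite -mj -[leLHS]mul1r ler_wpM2r // r_ge1 //; exists j.
    move=> i /negPf ne; case: eqP => // /eqP; rewrite eqn_exp2r // eq_sym ne //.
  rewrite big_nat big1 ?mulr_ge0 // => j /andP[_ lt_jJ]; case: ifP => // mj.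
  by case/negP: nex; apply/existsP; exists (Ordinal lt_jJ).
(* For each [n] the geometric series is cut at [k = floor(M/n)], and what is lost is at most
   [t^M <= s^M]. *)
have tail : `|\sum_(1 <= n < M.+1) X n * (t ^+ n / geom s n) - (1 - t) * \sum_(1
  <= m < M.+1) r m * t ^+ m| <= M%:R * s ^+ M.
  have -> : \sum_(1 <= m < M.+1) r m * t ^+ m = \sum_(1 <= n < M.+1) X n * \sum_(1 <= k <
    (M %/ n).+1) t ^+ (n * k).
    transitivity (\sum_(1 <= m < M.+1) \sum_(1 <= d < m.+1 | (d %| m)%N) X d * t ^+ (d * (m %/ d))).
      apply: eq_bigr => m _; rewrite /r mulr_suml; apply: eq_bigr => d dm.
      by rewrite mulnC divnK.
    rewrite (sum_dirichlet M (fun d k => X d * t ^+ (d * k))).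
    by apply: eq_bigr => n _; rewrite mulr_sumr.
  rewrite mulr_sumr -sumrB; apply: le_trans (ler_norm_sum _ _ _) _.
  have -> : M%:R * s ^+ M = \sum_(1 <= n < M.+1) s ^+ M by rewrite sumr_const_nat subn1 mulr_natl.
  apply: ler_sum_nat => n /andP[n_gt0 _].
  have g_ge1 : 1 <= geom s n by case: n n_gt0 => // n _; apply: geom_ge1.
  have g_gt0 : 0 < geom s n by apply: lt_le_trans g_ge1.
  have e : (1 - t) * \sum_(1 <= k < (M %/ n).+1) t ^+ (n * k) = (t ^+ n - t ^+ (n *
    (M %/ n).+1)) / geom s n.
    have eg : (1 - t) * geom s n = 1 - t ^+ n by rewrite -opprB mulNr -subrX1 opprB.
    apply: (@mulIf _ (geom s n)); rewrite ?gt_eqF // divfK ?gt_eqF // mulrAC eg.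
    elim: (M %/ n)%N => [|k IH]; first by rewrite big_geq // mulr0 muln1 subrr.
    by rewrite big_nat_recr //= mulrDr IH !mulnS !exprD; ring.
  have -> : X n * (t ^+ n / geom s n) - (1 - t) * (X n * \sum_(1 <= k < (M %/ n).+1) t ^+ (n * k)) =
     X n * (t ^+ (n * (M %/ n).+1) / geom s n).
    by rewrite [(1 - t) * (_ * _)]mulrCA e; ring.
  have q_ge0 : 0 <= t ^+ (n * (M %/ n).+1) / geom s n.
    by rewrite divr_ge0 ?(ltW g_gt0) // exprn_ge0 // ltW.
  rewrite normrM (ger0_norm q_ge0); apply: le_trans (ler_wpM2r q_ge0 (norm_char_le1 X_range n)) _.
  rewrite mul1r.
  apply: (@le_trans _ _ (t ^+ (n * (M %/ n).+1))).
    by rewrite ler_pdivrMr // ler_peMr // exprn_ge0 // ltW.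
  apply: (@le_trans _ _ (t ^+ M)).
    by rewrite ler_wiXn2l ?ltW // mulnC ltnW // ltn_ceil.
  by rewrite lerXn2r ?nnegrE ?(ltW s_gt0) ?(ltW t_gt0).
have t1 : 0 < 1 - t by rewrite subr_gt0.
move: tail; rewrite ler_norml => /andP[tail _].
move: main; rewrite -(ler_pM2l t1) => main.
lra.
Qed.

(** Up to truncation errors the lower bound is [(1 - t) J/2] and the upper bound [(1 - t) A], which
    is impossible for [J > 2 A + 2]. *)
Lemma real_char_nonvanishing : False.
Proof.
have [J hJ] : exists J : nat, 2 * A + 2 < J%:R.
  by exists (Num.bound (2 * A + 2)); apply: archi_boundP; rewrite addr_ge0 ?mulr_ge0.
have J_gt0 : (0 < J)%N by rewrite -(ltr0n R); apply: le_lt_trans hJ; rewrite addr_ge0 ?mulr_ge0.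
have Jr : 1 <= J%:R :> R by rewrite ler1n.
(* With [s = 1 - d] and [d = 1/K], Bernoulli's inequality gives [t^(J^2) >= 1 - 2 J^2 d = 1/2]. *)
pose K : R := (4 * J ^ 2)%:R; have K_ge1 : 4 <= K by rewrite /K ler_nat leq_pmulr // expn_gt0 J_gt0.
have [d defd] : exists d, d = K^-1 by eexists.
have d_gt0 : 0 < d by rewrite defd invr_gt0; lra.
have d_lt1 : d < 1 by rewrite defd invf_lt1; lra.
have Bernoulli k : 1 - k%:R * d <= (1 - d) ^+ k.
  elim: k => [|k IH]; first by rewrite mul0r subr0 expr0.
  rewrite exprS; apply: (@le_trans _ _ ((1 - d) * (1 - k%:R * d)));
    last by rewrite ler_wpM2l //; lra.
  rewrite -subr_ge0 -natr1 (_ : _ - _ = k%:R * d ^+ 2); last by ring.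
  by rewrite mulr_ge0 // exprn_ge0 // ltW.
have decay k : (1 - d) ^+ k * (1 + k%:R * d) <= 1.
  elim: k => [|k IH]; first by rewrite mul0r addr0 expr0 mulr1.
  apply: le_trans IH; rewrite exprSr -mulrA ler_wpM2l ?exprn_ge0 //; first lra.
  rewrite -subr_ge0 -natr1 (_ : _ - _ = k.+1%:R * d ^+ 2); last by rewrite -natr1; ring.
  by rewrite mulr_ge0 // exprn_ge0 // ltW.
(* For [m > Y] the truncation errors at [M = 2 m], at most [(2/d^2 + A)/m] by [decay], are below
   [d <= 1 - t]. *)
pose Y := (2 / d ^+ 2 + A) / d.
have Y_ge0 : 0 <= Y by rewrite divr_ge0 ?(ltW d_gt0) // addr_ge0 // divr_ge0 // exprn_ge0 // ltW.
have [m hm le_Jm] : exists2 m, Y < m%:R & (J ^ 2 <= 2 * m)%N.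
  exists (J ^ 2 + Num.bound Y)%N; last by rewrite mul2n -addnn -addnA leq_addr.
  by apply: (lt_le_trans (archi_boundP Y_ge0)); rewrite ler_nat leq_addl.
have m_gt0 : 0 < m%:R :> R by apply: le_lt_trans hm.
have s_int : 0 < 1 - d < 1 by apply/andP; split; lra.
have := le_trans (lambert_lower s_int le_Jm) (lambert_upper (2 * m) s_int).
set t := (1 - d) ^+ 2.
have tJ : 2^-1 <= t ^+ (J ^ 2).
  rewrite /t -exprM; apply: le_trans (Bernoulli _); rewrite defd /K.
  rewrite [X in _ <= 1 - X](_ : _ = 2^-1); first lra.
  have : (J ^ 2)%:R != 0 :> R by rewrite pnatr_eq0 -lt0n expn_gt0 J_gt0.
  by rewrite (natrM _ 2) (natrM _ 4); move: (J ^ 2)%:R => y y0; field.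
have sm : (2 * m)%:R * (1 - d) ^+ (2 * m) <= 2 / d ^+ 2 / m%:R.
  have h : (1 - d) ^+ m <= (m%:R * d)^-1.
    rewrite -[leRHS]mul1r ler_pdivlMr ?mulr_gt0 //; apply: le_trans (decay m).
    by rewrite ler_wpM2l ?exprn_ge0 ?lerDr //; lra.
  have h0 : 0 <= (1 - d) ^+ m by rewrite exprn_ge0 //; lra.
  have -> : 2 / d ^+ 2 / m%:R = (2 * m)%:R * ((m%:R * d)^-1 * (m%:R * d)^-1).
    by rewrite natrM; field; rewrite !gt_eqF.
  by rewrite ler_wpM2l // mulnC exprM expr2 ler_pM.
have Am : A / (2 * m).+1%:R <= A / m%:R.
  by rewrite ler_wpM2l // lef_pV2 ?posrE // ler_nat leqW // leq_pmull.
have t1 : d <= 1 - t.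
  have -> : 1 - t = d + d * (1 - d) by rewrite /t; ring.
  by rewrite lerDl mulr_ge0 ?ltW //; lra.
have low : (1 - t) * (J%:R / 2) <= (1 - t) * (J%:R * t ^+ (J ^ 2)).
  by rewrite ler_wpM2l ?(le_trans (ltW d_gt0) t1) // ler_wpM2l.
have gap : d * (J%:R / 2 - A) <= (1 - t) * (J%:R / 2 - A) by rewrite ler_wpM2r //; lra.
have gap2 : d < d * (J%:R / 2 - A) by rewrite ltr_pMr //; lra.
have fin : (2 / d ^+ 2 + A) / m%:R < d.
  by rewrite ltr_pdivrMr // -ltr_pdivrMl // mulrC.
move: fin; rewrite mulrDl; move: sm Am low gap gap2; rewrite !mulrBr.
move: (_ / m%:R) (A / m%:R) (A / _.+1%:R) (_ * (1 - d) ^+ _) ((1 - t) * (J%:R / 2)) => *; lra.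
Qed.
End NonVanishing.

(** * The group algebra *)

Lemma ln_unbounded (R : realType) (y : R) : exists x, (0 < x)%N /\ y < ln x%:R.
Proof.
have h : expR y < (Num.bound (expR y))%:R by apply: archi_boundP; apply: expR_ge0.
have x_gt0 : 0 < (Num.bound (expR y))%:R :> R by apply: lt_trans h; apply: expR_gt0.
exists (Num.bound (expR y)); split; first by rewrite -(ltr0n R).
by rewrite -[ltLHS]expRK ltr_ln ?posrE ?expR_gt0.
Qed.

Section GroupAlgebra.
Variables (R : realType) (G : finGroupType) (cls : nat -> option G).
Local Notation mangoldt := (@mangoldt R).
Local Notation moebius := (@moebius R).
Local Notation "1g" := (1%g : G).
Hypothesis mulgC : forall g h : G, (g * h = h * g)%g.
Hypothesis cls1 : cls 1 = Some 1g.
Hypothesis clsM : forall d k, cls (d * k) =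
  if cls d is Some g then if cls k is Some h then Some (g * h)%g else None else None.

(** Extension by zero to the integers without a class, as for a Dirichlet character. *)
Definition ext (v : G -> R) n : R := if cls n is Some g then v g else 0.

Hypothesis equidist : forall v, \sum_g v g = 0 -> exists A, bounded_sums (ext v) A.
Hypothesis cls_prime : exists P : nat, forall p, prime p -> (P < p)%N -> cls p != None.

Lemma ext_mul v d k : ext v (d * k) = ext (fun h => ext (fun g => v (h * g)%g) k) d.
Proof. by rewrite /ext clsM; case: (cls d) => // h; case: (cls k). Qed.

Lemma ext_linear (v : G -> G -> R) (w : G -> R) n :
  ext (fun h => \sum_g w g * v g h) n = \sum_g w g * ext (v g) n.
Proof.
rewrite /ext; case: (cls n) => // ; rewrite big1 // => g _; exact: mulr0.
Qed.

Definition abs_sum (v : G -> R) := \sum_g `|v g|.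

Lemma abs_sum_shift v h : abs_sum (fun g => v (h * g)%g) = abs_sum v.
Proof. by rewrite /abs_sum [RHS](reindex_inj (mulgI h)). Qed.

Lemma sum_shift (v : G -> R) h : \sum_g v (h * g)%g = \sum_g v g.
Proof. by rewrite [RHS](reindex_inj (mulgI h)). Qed.

Lemma card_group_gt0 : 0 < #|G|%:R :> R.
Proof. by rewrite ltr0n; apply/card_gt0P; exists 1g. Qed.

(** On functions of mean zero, pairing with [c] is the value at 1 of the L-function. Adding a
    constant to [c] does not change this, so its sum can be normalised to 1. *)
Lemma limit_functional : exists c : G -> R, exists C : R, [/\ \sum_g c g = 1, 0 <= C &
  forall v x, \sum_g v g = 0 ->
   `|\sum_(1 <= n < x.+1) ext v n / n%:R - \sum_g v g * c g| <= C * abs_sum v / x.+1%:R].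
Proof.
have cG := card_group_gt0.
pose dv (g h : G) : R := (g == h)%:R - #|G|%:R^-1.
have sum_const (y : R) : \sum_(g : G) y = #|G|%:R * y by rewrite sumr_const mulr_natl.
have dv0 g : \sum_h dv g h = 0.
  rewrite sumrB sum_const mulfV ?gt_eqF // (bigD1 g) //= eqxx big1 ?addr0 ?subrr //.
  by move=> h; rewrite eq_sym => /negPf->.
have [A hA] := choice (fun g => equidist (dv0 g)).
have [c0 hc0] := choice (fun g => harmonic_limit (hA g)).
have A_ge0 g : 0 <= A g by apply: le_trans (hA g 0 0)%N.
pose c g := c0 g + (1 - \sum_h c0 h) / #|G|%:R.
exists c, (\sum_g A g); split.
- by rewrite big_split /= sum_const mulrCA mulfV ?gt_eqF //; ring.
- exact: sumr_ge0.
move=> v x v0.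
have -> : \sum_g v g * c g = \sum_g v g * c0 g.
  under eq_bigr do rewrite mulrDr; by rewrite big_split /= -mulr_suml v0 mul0r addr0.
have -> : \sum_(1 <= n < x.+1) ext v n / n%:R
   = \sum_g v g * \sum_(1 <= n < x.+1) ext (dv g) n / n%:R.
  under [in RHS]eq_bigr do rewrite mulr_sumr.
  rewrite exchange_big /=; apply: eq_bigr => n _.
  under eq_bigr do rewrite mulrA; rewrite -mulr_suml; congr (_ / _).
  rewrite -ext_linear /ext; case: (cls n) => // h.
  rewrite /dv; under eq_bigr do rewrite mulrBr.
  rewrite sumrB -mulr_suml v0 mul0r subr0 (bigD1 h) //= eqxx mulr1 big1 ?addr0 // => g /negPf->.
  by rewrite mulr0.
rewrite -sumrB; apply: le_trans (ler_norm_sum _ _ _) _.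
rewrite /abs_sum mulr_sumr mulr_suml; apply: ler_sum => g _.
rewrite -mulrBr normrM [X in _ <= X / _]mulrC -mulrA ler_wpM2l //.
apply: le_trans (hc0 g x) _; rewrite ler_wpM2r ?invr_ge0 // (bigD1 g) //= lerDl.
exact: sumr_ge0.
Qed.

(** The value of [f] on the group algebra element [lam_x]. *)
Definition pairing x (f : G -> R) : R := \sum_(1 <= d < x.+1) mangoldt d / d%:R * ext f d.

Definition growth (f : G -> R) (al : R) :=
  exists K, forall x, (0 < x)%N -> `|pairing x f - al * ln x%:R| <= K.

Lemma eq_growth f g al : f =1 g -> growth f al -> growth g al.
Proof. by move=> /funext->. Qed.

Lemma growthD f g al be : growth f al -> growth g be -> growth (fun h => f h + g h) (al + be).
Proof.
move=> [K hK] [L hL]; exists (K + L) => x x_gt0.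
have -> : pairing x (fun h => f h + g h) = pairing x f + pairing x g.
  rewrite /pairing -big_split; apply: eq_bigr => d _ /=; rewrite -mulrDr; congr (_ * _).
  by rewrite /ext; case: (cls d); rewrite ?addr0.
rewrite mulrDl opprD addrACA; apply: le_trans (ler_normD _ _) _.
by rewrite lerD ?hK ?hL.
Qed.

Lemma growthZ f al y : growth f al -> growth (fun h => y * f h) (y * al).
Proof.
move=> [K hK]; exists (`|y| * K) => x x_gt0.
have -> : pairing x (fun h => y * f h) = y * pairing x f.
  rewrite /pairing mulr_sumr; apply: eq_bigr => d _; rewrite mulrCA; congr (_ * _).
  by rewrite /ext; case: (cls d); rewrite ?mulr0.
by rewrite -mulrA -mulrBr normrM ler_wpM2l ?hK.
Qed.

(** Mertens' estimate, less the integers without a class, which include only finitely many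
    primes. *)
Lemma growth1 : growth (fun=> 1) 1.
Proof.
have [P hP] := cls_prime.
pose B := \sum_(1 <= d < P.+1) mangoldt d / d%:R + 2.
exists (B + 4) => x x_gt0.
pose D := \sum_(1 <= d < x.+1) mangoldt d / d%:R.
have D_pair : 0 <= D - pairing x (fun=> 1) <= B.
  have -> : D - pairing x (fun=> 1) = \sum_(1 <= d < x.+1 | cls d == None) mangoldt d / d%:R.
    rewrite -sumrB [RHS]big_mkcond; apply: eq_bigr => d _; rewrite /ext.
    by case: (cls d) => [g|] /=; rewrite ?mulr1 ?subrr // mulr0 subr0.
  rewrite sumr_ge0 => [|d _]; last by rewrite divr_ge0 ?mangoldt_ge0.
  apply: sum_mangoldt_few_primes => p cp p_pr; rewrite leqNgt; apply/negP => lt_Pp.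
  by have := hP p p_pr lt_Pp; rewrite cp.
have := mertens R x_gt0; rewrite -/D mul1r !ler_norml => /andP[h1 h2].
by case/andP: D_pair => h3 h4; apply/andP; split; lra.
Qed.

(** * Growth of the pairing on the ideal of [c] and on its annihilator *)

Section WithLimit.
Variables (c : G -> R) (C : R).
Hypothesis c_sum : \sum_g c g = 1.
Hypothesis C_ge0 : 0 <= C.
Hypothesis c_lim : forall v x, \sum_g v g = 0 ->
   `|\sum_(1 <= n < x.+1) ext v n / n%:R - \sum_g v g * c g| <= C * abs_sum v / x.+1%:R.

Lemma inner_limit v x d : \sum_g v g = 0 -> (0 < d)%N -> (0 < x)%N ->
  `|\sum_(1 <= k < (x %/ d).+1) ext v (d * k) / k%:R
     - ext (fun h => \sum_g v (h * g)%g * c g) d| <= C * abs_sum v * d%:R / x%:R.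
Proof.
move=> v0 d_gt0 x_gt0.
have B_ge0 : 0 <= C * abs_sum v * d%:R / x%:R.
  by rewrite divr_ge0 // mulr_ge0 // mulr_ge0 // sumr_ge0.
have ext_d f : ext f d = if cls d is Some h then f h else 0 by [].
under eq_bigr do rewrite ext_mul ext_d.
rewrite ext_d; case: (cls d) => [h|]; last first.
  by rewrite big1 ?subr0 ?normr0 // => k _; rewrite mul0r.
apply: le_trans (c_lim _ _) _; first by rewrite sum_shift.
rewrite abs_sum_shift -[leRHS]mulrA ler_wpM2l //; first by rewrite mulr_ge0 // sumr_ge0.
rewrite -[leRHS]invf_div lef_pV2 ?posrE ?divr_gt0 ?ltr0n //.
exact/ltW/lt_floor_divS.
Qed.

(* From [ln = 1 * Lambda], as the sums of [v(n) ln n / n] are bounded. *)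
Lemma growth_conv0 v : \sum_g v g = 0 -> growth (fun h => \sum_g v (h * g)%g * c g) 0.
Proof.
move=> v0; have [A hA] := equidist v0.
have B_ge0 : 0 <= C * abs_sum v by rewrite mulr_ge0 // sumr_ge0.
exists (2 * A + C * abs_sum v * 4) => x x_gt0; rewrite mul0r subr0.
have xr : 0 < x%:R :> R by rewrite ltr0n.
have e : \sum_(1 <= n < x.+1) ext v n * ln n%:R / n%:R =
   \sum_(1 <= d < x.+1) mangoldt d / d%:R * \sum_(1 <= k < (x %/ d).+1) ext v (d * k) / k%:R.
  transitivity (\sum_(1 <= n < x.+1) \sum_(1 <= d < n.+1 | (d %| n)%N)
      (mangoldt d / d%:R * (ext v (d * (n %/ d)) / (n %/ d)%:R))).
    apply: eq_big_nat => n /andP[n_gt0 _].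
    rewrite -sum_mangoldt // mulr_sumr mulr_suml big_nat_cond [RHS]big_nat_cond.
    apply: eq_bigr => d /andP[/andP[d_gt0 _] dn].
    rewrite [in RHS]mulnC divnK // -{2}(divnK dn) natrM invfM; ring.
  rewrite (sum_dirichlet x (fun d k => mangoldt d / d%:R * (ext v (d * k) / k%:R))).
  by apply: eq_bigr => d _; rewrite mulr_sumr.
have h1 := bounded_sum_ln hA x; rewrite e in h1.
rewrite -[pairing _ _](subrK (\sum_(1 <= d < x.+1) mangoldt d / d%:R * \sum_(1 <= k <
  (x %/ d).+1) ext v (d * k) / k%:R)).
rewrite addrC; apply: le_trans (ler_normD _ _) _; apply: lerD => //.
rewrite distrC /pairing -sumrB; apply: le_trans (ler_norm_sum _ _ _) _.
(* Replacing the inner sums by their limits costs [C |v| psi(x)/x], bounded by Chebyshev's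
   estimate. *)
apply: (@le_trans _ _ (\sum_(1 <= d < x.+1) mangoldt d * (C * abs_sum v / x%:R))).
  apply: ler_sum_nat => d /andP[d_gt0 _].
  rewrite -mulrBr normrM [X in X * _]ger0_norm ?divr_ge0 ?mangoldt_ge0 //.
  have d_gt0r : 0 < d%:R :> R by rewrite ltr0n.
  have := inner_limit v0 d_gt0 x_gt0;
    move=> /(ler_wpM2l (divr_ge0 (mangoldt_ge0 R d) (ltW d_gt0r))).
  move=> h; apply: le_trans h _; rewrite le_eqVlt; apply/orP; left; apply/eqP.
  by field; rewrite !gt_eqF.
rewrite -mulr_suml -/(chebyshev_psi R x) mulrCA ler_wpM2l //.
by rewrite ler_pdivrMr // chebyshev_psi_le.
Qed.

(** Split [v] into its mean and a part of mean zero; the mean contributes through [growth1], since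
    [c] has sum 1. *)
Lemma growth_conv v : growth (fun h => \sum_g v (h * g)%g * c g) (#|G|%:R^-1 * \sum_g v g).
Proof.
set m := _ * _; pose v0 g := v g - m.
have v0_sum : \sum_g v0 g = 0.
  by rewrite sumrB sumr_const -[X in _ - X]mulr_natl /m mulrA mulfV ?gt_eqF ?card_group_gt0
    // mul1r subrr.
have := growthD (growth_conv0 v0_sum) (growthZ m growth1); rewrite add0r mulr1.
apply: eq_growth => h; rewrite /v0; under eq_bigr do rewrite mulrBl.
by rewrite sumrB -mulr_sumr c_sum !mulr1 subrK.
Qed.

(* Here the L-values of all translates of [v] vanish, and one sums
   [mu(d) (ln x - ln d)] over [d | n], which is [Lambda(n)] plus [ln x] at [n = 1]. *)
Lemma growth_ker v : \sum_g v g = 0 -> (forall h, \sum_g v (h * g)%g * c g = 0) ->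
  growth v (- v 1%g).
Proof.
move=> v0 vK; set B := C * abs_sum v.
have B_ge0 : 0 <= B by rewrite mulr_ge0 // sumr_ge0.
exists B => x x_gt0; have xr : 0 < x%:R :> R by rewrite ltr0n.
pose T := \sum_(1 <= d < x.+1) moebius d * (ln x%:R - ln d%:R) / d%:R * \sum_(1 <= k <
  (x %/ d).+1) ext v (d * k) / k%:R.
have -> : pairing x v - - v 1%g * ln x%:R = T.
  rewrite /T; under [RHS]eq_bigr do rewrite mulr_sumr.
  rewrite -(sum_dirichlet x (fun d k => moebius d * (ln x%:R - ln d%:R) / d%:R * (ext v
    (d * k) / k%:R))).
  transitivity (\sum_(1 <= n < x.+1) ((n == 1%N)%:R *
    (v 1%g * ln x%:R) + mangoldt n / n%:R * ext v n)).
    rewrite big_split /= -mulr_suml (bigD1_seq 1%N) ?iota_uniq ?mem_index_iota //= big1 ?addr0;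
      last first.
      by move=> n /negPf->.
    by rewrite mul1r mulNr opprK addrC.
  apply: eq_big_nat => n /andP[n_gt0 _].
  transitivity (\sum_(1 <= d < n.+1 | (d %| n)%N) moebius d * (ln x%:R - ln d%:R) *
    (ext v n / n%:R)).
    rewrite -mulr_suml sum_moebius_ln // mulrDl; congr (_ + _); last by ring.
    by case: eqP => [->|_]; rewrite ?mul0r // !mul1r /ext cls1 divr1 mulrC.
  rewrite big_nat_cond [RHS]big_nat_cond; apply: eq_bigr => d /andP[/andP[d_gt0 _] dn].
  by rewrite [in RHS]mulnC divnK // -{2}(divnK dn) natrM invfM; ring.
apply: le_trans (ler_norm_sum _ _ _) _.
apply: (@le_trans _ _ (\sum_(1 <= d < x.+1) (ln x%:R - ln d%:R) * (B / x%:R))).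
  apply: ler_sum_nat => d /andP[d_gt0 lt_dx].
  have dr : 0 < d%:R :> R by rewrite ltr0n.
  have ln_le : 0 <= ln x%:R - ln d%:R :> R by rewrite subr_ge0 ler_ln ?posrE // ler_nat.
  have := inner_limit v0 d_gt0 x_gt0.
  have -> : ext (fun h => \sum_g v (h * g)%g * c g) d = 0 by rewrite /ext; case: (cls d).
  rewrite subr0 -/B => hin.
  rewrite !normrM [X in _ * X * _ * _]ger0_norm // [X in _ * X * _]ger0_norm ?invr_ge0 //.
  apply: (@le_trans _ _ ((1 * (ln x%:R - ln d%:R)) / d%:R * (B * d%:R / x%:R))); last first.
    by rewrite le_eqVlt; apply/orP; left; apply/eqP; field; rewrite !gt_eqF.
  by rewrite ler_pM ?mulr_ge0 ?invr_ge0 // ler_wpM2r ?invr_ge0 // ler_wpM2r // norm_moebius_le1.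
(* The remaining sum of [ln x - ln d] is [x ln x - ln x!], at most [x]. *)
rewrite -mulr_suml mulrCA -[leRHS]mulr1 ler_wpM2l // ler_pdivrMr // mul1r.
have := ln_fact_ge R x.
have -> : \sum_(1 <= d < x.+1) (ln x%:R - ln d%:R) = x%:R * ln x%:R - ln (x`!)%:R :> R.
  rewrite sumrB sumr_const_nat subn1 /= mulr_natl; congr (_ - _).
  elim: (x) => [|y IH]; first by rewrite big_geq // fact0 ln1.
  by rewrite big_nat_recr //= IH factS natrM lnM ?posrE ?ltr0n ?fact_gt0 // addrC.
lra.
Qed.
End WithLimit.

Lemma growth_ge0 f al : growth f (al : R) -> (forall g, 0 <= f g) -> 0 <= al.
Proof.
move=> [K hK] f_ge0; rewrite leNgt; apply/negP => al_lt0.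
have [x [x_gt0 hx]] := ln_unbounded (K / - al).
have := hK x x_gt0; rewrite ler_norml => /andP[_].
have p_ge0 : 0 <= pairing x f.
  apply: sumr_ge0 => d _; rewrite mulr_ge0 ?divr_ge0 ?mangoldt_ge0 // /ext.
  by case: (cls d).
move: hx; rewrite ltr_pdivrMr ?oppr_gt0 // => h1 h2; lra.
Qed.

Lemma growth_delta b : growth (fun g => (g == b)%:R) (#|G|%:R^-1 : R).
Proof.
have cG := card_group_gt0.
have [c [C [c_sum C_ge0 c_lim]]] := limit_functional.
have conv := growth_conv c_sum C_ge0 c_lim.
have ker := growth_ker C_ge0 c_lim.
(* The unit of the algebra is projected onto the span of the translates of [c]; [e] is the
   orthogonal remainder. *)
have [w [e [dec eK]]] := orthogonal_decomposition (fun h k : G => c (h^-1 * k)%g) (fun g : G =>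
  (g == 1g)%:R).
have shiftV (f : G -> R) k : \sum_h f (h^-1 * k)%g = \sum_h f h.
  rewrite [RHS](reindex_inj (h := fun h => (h^-1 * k)%g)) // => x y /mulIg /invg_inj //.
have e_sum : \sum_g e g = 0.
  have : \sum_h \sum_k c (h^-1 * k)%g * e k = 0 by rewrite big1.
  by rewrite exchange_big /=; under eq_bigr do rewrite -mulr_suml shiftV c_sum mul1r.
have w_sum : \sum_g w g = 1.
  have : \sum_k (k == 1g)%:R = 1 :> R.
    by rewrite (bigD1 1g) //= eqxx big1 ?addr0 // => g /negPf->.
  under eq_bigr do rewrite dec; rewrite big_split /= e_sum addr0 exchange_big /=.
  by under eq_bigr do rewrite -mulr_sumr (sum_shift c) c_sum mulr1.
have eKs b' h : \sum_k c (h^-1 * k)%g * e (b' * k)%g = 0.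
  rewrite -[RHS](eK (b' * h)%g) [RHS](reindex_inj (mulgI b')); apply: eq_bigr => k _.
  by rewrite invMg mulgA -[(h^-1 * _ * b')%g]mulgA mulVg mulg1.
(* [e] is the reproducing kernel of the annihilator of [c] *)
have repr b' : e b' = \sum_k e k * e (b' * k)%g.
  have : \sum_k (k == 1g)%:R * e (b' * k)%g = e b'.
    rewrite (bigD1 1g) //= eqxx mul1r mulg1 big1 ?addr0 // => g /negPf->; exact: mul0r.
  move=> <-; under eq_bigr do rewrite dec mulrDl.
  rewrite big_split /= [X in X + _](_ : _ = 0) ?add0r //.
  under eq_bigr do rewrite mulr_suml.
  rewrite exchange_big /= big1 // => h _.
  by under eq_bigr do rewrite -mulrA; rewrite -mulr_sumr eKs mulr0.
have eV b' : e b'^-1%g = e b'.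
  rewrite repr [RHS]repr [RHS](reindex_inj (mulgI b'^-1%g)); apply: eq_bigr => k _.
  by rewrite mulgA mulgV mul1g mulrC.
(* The indicator of [b'] at [h] is that of the identity at [h^-1 b']; its [w] part falls under
   [growth_conv], its [e] part under [growth_ker]. *)
have gr b' : growth (fun g => (g == b')%:R) (#|G|%:R^-1 - e b' : R).
  have g1 := conv (fun y => w (b' * y^-1)%g).
  have g2 : growth (fun h => e (b'^-1 * h)%g) (- e b').
    have := ker (fun h => e (b'^-1 * h)%g); rewrite mulg1 eV; apply.
      by rewrite sum_shift.
    move=> h; rewrite -[RHS](eKs b'^-1%g h) [RHS](reindex_inj (mulgI h)).
    by apply: eq_bigr => k _; rewrite mulrC mulKg.
  have ws : \sum_g w (b' * g^-1)%g = 1.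
    rewrite -w_sum [RHS](reindex_inj (h := fun g => (b' * g^-1)%g)) // => x y /mulgI /invg_inj //.
  have := growthD g1 g2; rewrite ws mulr1; apply: eq_growth => h.
  transitivity (((h^-1 * b')%g == 1g)%:R : R).
    rewrite dec; congr (_ + _); last by rewrite -eV invMg invgK.
    rewrite [RHS](reindex_inj (h := fun g => (h^-1 * b' * g^-1)%g)) => [|x y /mulgI /invg_inj //].
    apply: eq_bigr => g _; congr (w _ * c _); first by rewrite invMg mulgA [LHS]mulgC mulgA.
    by rewrite [in RHS]invMg invgK -mulgA mulVg mulg1.
  by congr (_%:R); rewrite -(inj_eq (mulgI h)) mulgA mulgV mul1g mulg1 eq_sym.
(* It remains to see that [e = 0]: otherwise [|G| e] is a real character violating
  [real_char_nonvanishing]. *)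
suff e0 : e b = 0 by have := gr b; rewrite e0 subr0.
have e_le b' : e b' <= #|G|%:R^-1.
  by rewrite -subr_ge0; apply: growth_ge0 (gr b') _ => g; apply: ler0n.
have e1 : e 1g = \sum_k e k ^+ 2.
  by rewrite repr; apply: eq_bigr => k _; rewrite mul1g expr2.
have e1_ge0 : 0 <= e 1g by rewrite e1 sumr_ge0 // => k _; apply: sqr_ge0.
have [e10|e1_neq0] := eqVneq (e 1g) 0.
  have := e1; rewrite e10 => /esym/eqP; rewrite psumr_eq0 => [/allP/(_ b (mem_index_enum _))|k _].
    by rewrite sqrf_eq0 => /eqP.
  exact: sqr_ge0.
exfalso; have e1_gt0 : 0 < e 1g by rewrite lt_def e1_neq0.
have sq_shift k : \sum_h e (k * h)%g ^+ 2 = e 1g.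
  by rewrite e1 [RHS](reindex_inj (mulgI k)).
(* Expanded through [repr], these sums of squares show [|e k| <= e 1]; in the case of equality one
   of them vanishes, so translation by [k] fixes [e] or negates it. *)
have sqB k : \sum_h (e h - e (k * h)%g) ^+ 2 = 2 * (e 1g - e k).
  under eq_bigr do rewrite sqrrB.
  rewrite big_split sumrB /= sq_shift -e1 sumrMnl -repr; ring.
have sqD k : \sum_h (e h + e (k * h)%g) ^+ 2 = 2 * (e 1g + e k).
  under eq_bigr do rewrite sqrrD.
  rewrite big_split /= big_split /= sq_shift -e1 sumrMnl -repr; ring.
have sq_le k : e k ^+ 2 <= e 1g ^+ 2.
  have h1 : 0 <= 2 * (e 1g - e k) by rewrite -sqB sumr_ge0 // => h _; apply: sqr_ge0.
  have h2 : 0 <= 2 * (e 1g + e k) by rewrite -sqD sumr_ge0 // => h _; apply: sqr_ge0.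
  rewrite -subr_ge0 subr_sqr mulr_ge0 //; lra.
have sq_eq_sum : \sum_k (e 1g ^+ 2 - e k ^+ 2) = (#|G|%:R * e 1g - 1) * e 1g.
  by rewrite sumrB -e1 sumr_const -[X in X - _]mulr_natl; ring.
(* Positivity gives one inequality, the sign of the sum above the other; hence that sum vanishes and
   all [|e k|] equal [1/|G|]. *)
have Ge1 : #|G|%:R * e 1g = 1.
  apply/eqP; rewrite eq_le -ler_pdivlMl // mulr1 e_le /=.
  rewrite -subr_ge0 -(pmulr_lge0 _ e1_gt0) -sq_eq_sum sumr_ge0 // => k _.
  by rewrite subr_ge0.
have sq_eq k : e k ^+ 2 = e 1g ^+ 2.
  have := sq_eq_sum; rewrite Ge1 subrr mul0r => /eqP.
  rewrite psumr_eq0 => [/allP/(_ k (mem_index_enum _))|h _]; last by rewrite subr_ge0.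
  by rewrite subr_eq0 => /eqP.
pose chi g := #|G|%:R * e g.
have chi_pm g : chi g = 1 \/ chi g = -1.
  have /eqP := sq_eq g; rewrite eqf_sqr /chi => /orP[]/eqP->; first by left.
  by right; rewrite mulrN Ge1.
have chiM g h : chi (g * h)%g = chi g * chi h.
  have zero (f : G -> R) : \sum_k f k ^+ 2 = 0 -> f h = 0.
    move=> /eqP; rewrite psumr_eq0 => [/allP/(_ h (mem_index_enum _))|k _]; last exact: sqr_ge0.
    by rewrite sqrf_eq0 => /eqP.
  have /eqP := sq_eq g; rewrite eqf_sqr => /orP[]/eqP eg.
    have h0 : \sum_k (e k - e (g * k)%g) ^+ 2 = 0 by rewrite sqB eg subrr mulr0.
    have /eqP := zero _ h0; rewrite subr_eq0 => /eqP hh.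
    by rewrite /chi eg Ge1 mul1r hh.
  have h0 : \sum_k (e k + e (g * k)%g) ^+ 2 = 0 by rewrite sqD eg subrr mulr0.
  have /eqP := zero _ h0; rewrite addrC addr_eq0 => /eqP hh.
  by rewrite /chi eg hh !mulrN Ge1 mulN1r.
have chi_sum : \sum_g chi g = 0 by rewrite -mulr_sumr e_sum mulr0.
have [A hA] := equidist chi_sum.
pose B := C * abs_sum chi.
have A_ge0 : 0 <= A by apply: le_trans (hA 0 0)%N.
have B_ge0 : 0 <= B by rewrite mulr_ge0 // sumr_ge0.
apply: (@real_char_nonvanishing R (ext chi) (A + B)).
- by rewrite /ext cls1 /chi Ge1.
- move=> m n; rewrite /ext clsM; case: (cls m) => [g|]; last by rewrite mul0r.
  by case: (cls n) => [h|]; rewrite ?mulr0.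
- move=> n; rewrite /ext; case: (cls n) => [g|]; last by constructor 2.
  by case: (chi_pm g) => ->; [constructor 1|constructor 3].
- by move=> m n; apply: le_trans (hA m n) _; rewrite lerDl.
- move=> x; have := c_lim chi x chi_sum.
  (* The L-value of [chi] at 1 is zero because [e] is orthogonal to [c]. *)
  have -> : \sum_g chi g * c g = 0.
    under eq_bigr do rewrite -mulrA; rewrite -mulr_sumr -[RHS](mulr0 #|G|%:R); congr (_ * _).
    by rewrite -[RHS](eK 1g); apply: eq_bigr => g _; rewrite invg1 mul1g mulrC.
  rewrite subr0 => h; apply: le_trans h _; rewrite ler_wpM2r ?invr_ge0 //.
  by rewrite lerDr.
Qed.

Lemma pairing_delta_unbounded b (y : R) : exists x, y < pairing x (fun g => (g == b)%:R).
Proof.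
have [K hK] := growth_delta b; have cG := card_group_gt0.
have [x [x_gt0 hx]] := ln_unbounded (#|G|%:R * (y + K)).
exists x; have := hK x x_gt0; rewrite ler_norml => /andP[h _].
move: hx; rewrite -ltr_pdivlMl // => hx; lra.
Qed.
End GroupAlgebra.

(** * Primes in arithmetic progressions *)

Section ResidueClasses.
Variables (R : realType) (N : nat).
Hypothesis N_gt1 : (1 < N)%N.

Definition residue n : option {unit 'Z_N} := insub (n%:R : 'Z_N).

Lemma residue1 : residue 1 = Some 1%g.
Proof. by rewrite /residue; case: insubP => [u _ hu|]; [congr Some;
  apply: val_inj | rewrite unitr1]. Qed.

Lemma residueM d k : residue (d * k) =
  if residue d is Some g then if residue k is Some h then Some (g * h)%g else None else None.
Proof.
rewrite /residue natrM; case: (insubP _ (d%:R : 'Z_N)) => [u du hu|du]; last first.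
  by rewrite insubF // unitrM (negPf du).
case: (insubP _ (k%:R : 'Z_N)) => [w kw hw|kw]; last first.
  by rewrite insubF // unitrM (negPf kw) andbF.
by rewrite -hu -hw -[X in insub X]/(val (u * w)%g) valK.
Qed.

Lemma residue_Some n (u : {unit 'Z_N}) : (residue n == Some u) = (n %% N == val u)%N.
Proof.
have -> : (n %% N == val u)%N = ((n%:R : 'Z_N) == val u) by rewrite -val_Zp_nat.
rewrite /residue; case: insubP => [w _ <-|nu]; first by rewrite (inj_eq Some_inj) (inj_eq val_inj).
by apply/esym; apply: contraNF nu => /eqP->; apply: (valP u).
Qed.

Lemma residue_coprime n : coprime n N -> exists u, residue n = Some u.
Proof. by move=> cop; rewrite /residue insubT ?unitZpE 1?coprime_sym // => h; eexists. Qed.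

Lemma residue_prime : exists P : nat, forall p, prime p -> (P < p)%N -> residue p != None.
Proof.
exists N => p p_pr lt_Np; rewrite /residue insubT // unitZpE // coprime_sym prime_coprime //.
by rewrite gtnNdvd // ltnW.
Qed.

(** The sum over a full period vanishes, so the initial sums are periodic and hence bounded. *)
Lemma residue_equidist (v : {unit 'Z_N} -> R) : \sum_g v g = 0 ->
  exists A, bounded_sums (ext residue v) A.
Proof.
move=> v0; have N_gt0 := ltnW N_gt1; set a := ext residue v.
have aE i : a i = \sum_(g : {unit 'Z_N}) if (i %% N == val g)%N then v g else 0.
  under eq_bigr do rewrite -residue_Some.
  rewrite /a /ext; case: (residue i) => [u|]; last by rewrite big1.
  rewrite (bigD1 u) //= eqxx big1 ?addr0 // => g gu.
  by rewrite (inj_eq Some_inj) eq_sym (negPf gu).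
pose F n := \sum_(0 <= i < n) a i.
have F_period : F N = 0.
  rewrite -v0 /F; under eq_bigr do rewrite aE.
  rewrite exchange_big /=; apply: eq_bigr => g _.
  transitivity (\sum_(0 <= i < N) if (i == val g)%N then v g else 0).
    by apply: eq_big_nat => i /andP[_ lt_iN]; rewrite modn_small.
  have lt_gN : (val g < N)%N by apply: leq_trans (ltn_ord (val g : 'Z_N)) _; rewrite Zp_cast.
  by rewrite -big_mkcond big_nat1_eq lt_gN.
have FD n : F (N + n)%N = F n.
  rewrite /F (@big_cat_nat _ _ _ N) ?leq_addr //= -/(F N) F_period add0r.
  rewrite -{1}[N]add0n big_addn addKn; apply: eq_bigr => i _.
  by rewrite !aE; apply: eq_bigr => g _; rewrite modnDr.
have FM q n : F (q * N + n)%N = F n by elim: q => // q IH; rewrite mulSn -addnA FD.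
pose B := \sum_(0 <= i < N) `|a i|.
have F_le n : `|F n| <= B.
  rewrite (divn_eq n N) FM /F; apply: le_trans (ler_norm_sum _ _ _) _.
  rewrite /B [leRHS](@big_cat_nat _ _ _ (n %% N)%N) ?(ltnW (ltn_pmod n N_gt0)) //= lerDl.
  exact: sumr_ge0.
exists (B + B) => m n; have [le_nm|/ltnW le_mn] := leqP n m.
  by rewrite big_geq // normr0 -mulr2n mulrn_wge0 // (le_trans _ (F_le 0)).
have -> : \sum_(m <= i < n) a i = F n - F m by rewrite /F [in RHS](@big_cat_nat _ _ _ m)
  //= addrAC subrr add0r.
by apply: le_trans (ler_normB _ _) _; rewrite lerD.
Qed.

End ResidueClasses.

(** Were all primes of the class at most [m], the pairing with its indicator would stay bounded,
    against [pairing_delta_unbounded]. *)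
Theorem dirichlet_primes (R : realType) N b m : (1 < N)%N -> coprime b N ->
  exists q, [/\ prime q, (m < q)%N & q = b %[mod N]].
Proof.
move=> N_gt1 cop; have [u res_b] := residue_coprime N_gt1 cop.
have res_eq n : (residue N n == Some u) = (n == b %[mod N]).
  by move/eqP: res_b; rewrite !residue_Some // => /eqP->.
apply/not_existsP => none.
pose B : R := \sum_(1 <= d < m.+1) mangoldt R d / d%:R + 2.
have p_le x : pairing (residue N) x (fun g => (g == u)%:R : R) <= B.
  have -> : pairing (residue N) x (fun g => (g == u)%:R : R) =
      \sum_(1 <= d < x.+1 | residue N d == Some u) mangoldt R d / d%:R.
    rewrite [RHS]big_mkcond; apply: eq_bigr => d _; rewrite /ext.
    case: (residue N d) => [g|]; last by rewrite mulr0.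
    by rewrite (inj_eq Some_inj); case: eqP => _; rewrite ?mulr1 ?mulr0.
  apply: sum_mangoldt_few_primes => p res_p p_pr; rewrite leqNgt; apply/negP => lt_mp.
  by apply: (none p); split=> //; apply/eqP; rewrite -res_eq.
have [x] := @pairing_delta_unbounded R {unit 'Z_N} (residue N) (@unit_Zp_mulgC _)
  (residue1 N) (@residueM N) (@residue_equidist R N N_gt1) (residue_prime N_gt1) u B.
by rewrite ltNge p_le.
Qed.

(* Difference computed in int to avoid truncated nat subtraction. *)
Theorem theorem2p4 (p : nat) (hp : (1 < p)%N) :
  prime p <->
  (forall q : nat, prime q ->
     (Posz p %| (Posz 'C(q, p) - Posz (q %/ p))%R)%Z).
Proof.
split=> [p_pr q _|h]; first exact/dvdz_subn/prime_bin_mod.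
have p_gt0 := ltnW hp; apply/negPn/negP => p_npr.
have [b [_ cop]] := composite_residue hp p_npr; apply.
have N_gt1 : (1 < p ^ p.+1)%N by rewrite -(exp1n p.+1) ltn_exp2r.
(* Asking for [q > b] lets [q] be written as [b + k p^(p+1)] with a natural number [k]; the failure
   at [b] then carries over to the prime [q]. *)
have [q [q_pr lt_bq q_b]] := @dirichlet_primes Rdefinitions.R _ b b N_gt1 (coprimeXr _ cop).
have [k def_q] : exists k, q = (b + k * p ^ p.+1)%N.
  have /dvdnP[k def_k] : (p ^ p.+1 %| q - b)%N by rewrite -eqn_mod_dvd ?q_b // ltnW.
  by exists k; rewrite -def_k subnKC // ltnW.
have /dvdz_subn := h q q_pr; rewrite def_q bin_modD_pow // => ->.
rewrite expnSr mulnA divnDMl // -modnDmr (_ : (k * p ^ p) %% p = 0)%N ?addn0 //.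
by apply/eqP/dvdn_mull/dvdn_exp.
Qed.
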